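(* Let $\{\mathbb{A},\mathbb{B},c\}$ be a two-person zero-sum game satisfying: (i) for each $b\in\mathbb{B}$ the function $a\mapsto c(a,b)$ is lower semi-continuous on $\mathbb{A}$; (ii) there exists $b_0\in\mathbb{B}$ such that the function $a\mapsto c(a,b_0)$ is inf-compact on $\mathbb{A}$. Then the game has a lopsided value $v$, that is, $$\sup_{\pi^{\mathbb B}\in\mathbb{P}^S(\mathbb{B})}\hat c^{\flat}(\pi^{\mathbb B})=\inf_{\pi^{\mathbb A}\in\mathbb{P}(\mathbb{A})}\hat c^{\sharp}(\pi^{\mathbb A})=:v,$$ and $$\sup_{\pi^{\mathbb B}\in\mathbb{P}^S(\mathbb{B})}\hat c^{\flat}(\pi^{\mathbb B})=\sup_{\pi^{\mathbb B}\in\mathbb{P}^{fs}(\mathbb{B})}\hat c^{\flat}(\pi^{\mathbb B}).$$ Moreover, the set $\mathbb{P}^\sharp_v(\mathbb{A})=\{\pi^{\mathbb A}\in\mathbb{P}(\mathbb{A}):\hat c^\sharp(\pi^{\mathbb A})\le v\}$ is a nonempty convex compact subset of $\mathbb{P}(\mathbb{A})$.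
   Context: A two-person zero-sum game is a triplet $\{\mathbb{A},\mathbb{B},c\}$ where $\mathbb{A}$ and $\mathbb{B}$ are nonempty Borel subsets of Polish spaces, $c:\mathbb{A}\times\mathbb{B}\to\mathbb{R}$ is Borel measurable, for each $b\in\mathbb{B}$ the function $a\mapsto c(a,b)$ is bounded from below on $\mathbb{A}$, and for each $a\in\mathbb{A}$ the function $b\mapsto c(a,b)$ is bounded from above on $\mathbb{B}$. $\mathbb{P}(E)$ is the set of Borel probability measures on $E$ with the topology of weak convergence; $\mathbb{P}^{fs}(E)$ is the subset of measures with finite support. A function $g:E\to\mathbb{R}\cup\{\pm\infty\}$ is inf-compact on $E$ if $\{g\le\lambda\}$ is compact for every $\lambda\in\mathbb{R}$. With $c^+=\max\{c,0\}$, $c^-=\min\{c,0\}$, set $\hat c^{\oplus}(\pi^{\mathbb A},\pi^{\mathbb B})=\int_{\mathbb A}\int_{\mathbb B}c^+\,d\pi^{\mathbb B}d\pi^{\mathbb A}$, $\hat c^{\ominus}(\pi^{\mathbb A},\pi^{\mathbb B})=\int_{\mathbb A}\int_{\mathbb B}c^-\,d\pi^{\mathbb B}d\pi^{\mathbb A}$, and $\hat c=\hat c^\oplus+\hat c^\ominus$, which is well-defined at $(\pi^{\mathbb A},\pi^{\mathbb B})$ if $\hat c^\oplus<+\infty$ or $\hat c^\ominus>-\infty$ there. A point $a$ (or $b$) as an argument of $\hat c$ stands for the measure concentrated at that point. $\mathbb{P}^S(\mathbb{B})$ is the set of $\pi^{\mathbb B}\in\mathbb{P}(\mathbb{B})$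 such that $\hat c(\pi^{\mathbb A},\pi^{\mathbb B})$ is well-defined for all $\pi^{\mathbb A}\in\mathbb{P}(\mathbb{A})$. $\hat c^{\sharp}(\pi^{\mathbb A})=\sup_{b\in\mathbb{B}}\hat c(\pi^{\mathbb A},b)$ and $\hat c^{\flat}(\pi^{\mathbb B})=\inf_{a\in\mathbb{A}}\hat c(a,\pi^{\mathbb B})$ (these expected payoffs are always well-defined by the boundedness conditions on $c$). *)

(* Defs.v *)
From HB Require Import structures.
From mathcomp Require Import all_boot all_order all_algebra.
From mathcomp Require Import all_classical all_reals all_analysis.

Set Implicit Arguments.
Unset Strict Implicit.
Unset Printing Implicit Defensive.

Import Order.TTheory GRing.Theory Num.Theory.
Import numFieldNormedType.Exports.

Local Open Scope classical_set_scope.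
Local Open Scope ring_scope.

(* A Polish space is presented as a [separable] completeMetricType; the metric
   is an arbitrary complete one inducing the topology. *)
#[short(type="completeMetricType")]
HB.structure Definition CompleteMetric (K : numDomainType) :=
  {T of Metric K T & Complete T}.

Definition separable (T : topologicalType) : Prop :=
  exists2 D : set T, countable D & dense D.

Notation borel T := (g_sigma_algebraType (@open T)).

(* [set_type A] with its relative topology.  The proof of nonemptiness is a
   parameter because measurable types are required to be pointed. *)
Definition nonempty_subspace (X : topologicalType) (A : set X)
  (A0 : A !=set0) : Type := set_type A.

Section nonempty_subspace.
Context (X : topologicalType) (A : set X) (A0 : A !=set0).

HB.instance Definition _ :=
  Topological.copy (nonempty_subspace A0) (set_type A).

Definition subspace_point : nonempty_subspace A0 :=
  let: exist a Aa := cid A0 in exist _ a (mem_set Aa).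

HB.instance Definition _ := isPointed.Build (nonempty_subspace A0)
  subspace_point.

End nonempty_subspace.

Definition bounded_continuous (R : realType) (T : topologicalType) : Type :=
  {f : T -> R | continuous f /\ bounded_fun f}.

HB.instance Definition _ (R : realType) (T : topologicalType) :=
  gen_eqMixin (bounded_continuous R T).
HB.instance Definition _ (R : realType) (T : topologicalType) :=
  gen_choiceMixin (bounded_continuous R T).

(* The topology of weak convergence: the coarsest one making
   mu |-> \int[mu]_x f x continuous for every bounded continuous f. *)
Definition weak_evaluation (R : realType) (T : ptopologicalType)
    (mu : probability (borel T) R) : {ptws bounded_continuous R T -> R} :=
  fun f => \int[mu]_x (sval f x).

HB.instance Definition _ (R : realType) (T : ptopologicalType) :=
  Topological.copy (probability (borel T) R)
    (initial_topology (@weak_evaluation R T)).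

Section probabilities.
Context (R : realType) (T : ptopologicalType).
Implicit Types (mu nu : probability (borel T) R) (t : {i01 R}).

Definition point_mass (x : T) : probability (borel T) R :=
  @dirac _ (borel T) x R.

Definition support mu : set T :=
  \bigcap_(C in [set C : set T | closed C /\ mu C = 1%E]) C.

Definition finitely_supported : set (probability (borel T) R) :=
  [set mu | finite_set (support mu)].

Definition mixture t mu nu : set (borel T) -> \bar R :=
  measure_add (mscale (t%:num)%:nng mu) (mscale (1 - t%:num)%:nng nu).

HB.instance Definition _ t mu nu := Measure.on (mixture t mu nu).

Let mixture_setT t mu nu : mixture t mu nu setT = 1%E.
Proof.
rewrite /mixture measure_addE/= /mscale/= !probability_setT !mule1.
by rewrite -EFinD addrC subrK.
Qed.

HB.instance Definition _ t mu nu :=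
  @Measure_isProbability.Build _ _ R (mixture t mu nu) (mixture_setT t mu nu).

Definition convex_probabilities (S : set (probability (borel T) R)) : Prop :=
  forall t mu nu, S mu -> S nu -> S (mixture t mu nu).

End probabilities.

Definition inf_compact (R : realType) (T : topologicalType) (g : T -> \bar R) :
  Prop := forall l : R, compact [set x | (g x <= l%:E)%E].

Section payoffs.
Context (R : realType) (A B : ptopologicalType) (c : A * B -> R).
Implicit Types (pA : probability (borel A) R) (pB : probability (borel B) R).

Definition game_payoff : Prop :=
  [/\ measurable_fun [set: borel (A * B)%type] c,
      forall b, has_lbound (range (fun a => c (a, b))) &
      forall a, has_ubound (range (fun b => c (a, b)))].

Local Open Scope ereal_scope.

Definition expected_pos pA pB : \bar R :=
  \int[pA]_a \int[pB]_b (Num.max (c (a, b)) 0)%:E.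

Definition expected_neg pA pB : \bar R :=
  \int[pA]_a \int[pB]_b (Num.min (c (a, b)) 0)%:E.

Definition expected_payoff_defined pA pB : Prop :=
  expected_pos pA pB < +oo \/ -oo < expected_neg pA pB.

(* Meaningful only under [expected_payoff_defined]. *)
Definition expected_payoff pA pB : \bar R :=
  expected_pos pA pB + expected_neg pA pB.

Definition safe_strategies : set (probability (borel B) R) :=
  [set pB | forall pA, expected_payoff_defined pA pB].

Definition payoff_sharp pA : \bar R :=
  ereal_sup (range (fun b => expected_payoff pA (point_mass R b))).

Definition payoff_flat pB : \bar R :=
  ereal_inf (range (fun a => expected_payoff (point_mass R a) pB)).

Definition sharp_sublevel (v : \bar R) : set (probability (borel A) R) :=
  [set pA | payoff_sharp pA <= v].

End payoffs.

(* Main.v *)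
Require Import Defs.
From HB Require Import structures.
From mathcomp Require Import all_boot all_order all_algebra.
From mathcomp Require Import all_classical all_reals all_analysis measurable_realfun.
From mathcomp Require Import ring lra.

Set Implicit Arguments.
Unset Strict Implicit.
Unset Printing Implicit Defensive.

Import Order.TTheory GRing.Theory Num.Theory.
Import numFieldNormedType.Exports.

Local Open Scope classical_set_scope.
Local Open Scope ring_scope.

(** The heart of the proof is the compactness of
    {p : \int c(., b0) dp <= l} in the weak topology.  Along an ultrafilter
    concentrated on this set the integrals of every bounded continuous function
    converge; inf-compactness of c(., b0) makes the limit functional continuous
    along increasing sequences (Dini on a compact sublevel set), so by a Riesz
    construction it is integration against a probability.  Since integrals of
    lower semicontinuous functions are lower semicontinuous in the measure, all
    sets {p : \int c(., b) dp <= l} are closed.  For finitely many b's a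
    separation argument yields a p in all of these sets as soon as l exceeds
    the supremum of the flat payoffs of the finitely supported strategies;
    compactness then gives a p that works for every b at once, and Fubini gives
    the converse inequality. *)

(** * Lower semicontinuous and bounded functions *)

(** Two obstacles shape the proof. The strategy space of the minimizer need be neither compact nor
    locally compact, so a positive functional on bounded continuous functions may lose mass at
    infinity and fail to be an integral. A bound on the integral of [c(., b0)] prevents this:
    outside a compact sublevel set, every bounded function is dominated by a small multiple of
    [c(., b0)], shifted to be nonnegative. Increasing sequences suffice in the continuity condition
    because in a metric space the indicator of an open set is the limit of such a sequence of
    continuous functions. The distance is that of the ambient space, while the subspace carries only
    its topology; hence a distance passed as a plain function. The second obstacle is infinity minus
    infinity: positive and negative parts are integrated separately, inequalities between payoffs
    are rearranged into nonnegative terms before integration, and Fubini is used in Tonelli's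
    form. *)

Definition metrized_by (R : realType) (T : topologicalType) (d : T -> T -> R) :=
  [/\ forall x, d x x = 0,
      forall x y, 0 <= d x y,
      forall x y, d x y = d y x,
      forall y x z, d x z <= d x y + d y z &
      forall x (U : set T),
        nbhs x U <-> exists2 e, 0 < e & forall y, d x y < e -> U y].

Section lower_semicontinuity.
Context (R : realType) (T : ptopologicalType).
Implicit Types f g : T -> R.

Definition lsc f := forall r, open [set x | r < f x].

Lemma lscP f : lower_semicontinuous (fun x => (f x)%:E) <-> lsc f.
Proof.
split=> [/lower_semicontinuousP h r|h].
  by have := h r; under eq_set do rewrite lte_fin.
apply/lower_semicontinuousP => r; under eq_set do rewrite lte_fin; exact: h.
Qed.

Lemma lsc_measurable f : lsc f -> measurable_fun setT (f : borel T -> R).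
Proof.
move=> fl; apply: (measurability _ (RGenOInfty.measurableE R)).
move=> /= _ [_ [a ->]] <-; rewrite setTI; apply: sub_sigma_algebra.
by rewrite preimage_itvoy; exact: fl.
Qed.

Lemma continuous_lsc f : continuous f -> lsc f.
Proof.
move=> fc r; rewrite -preimage_itvoy.
by apply: open_comp => [x _|]; [exact: fc|exact: interval_open].
Qed.

Lemma continuous_borel_measurable f :
  continuous f -> measurable_fun setT (f : borel T -> R).
Proof. by move=> /continuous_lsc/lsc_measurable. Qed.

Lemma lsc_addr f k : lsc f -> lsc (fun x => f x + k).
Proof. by move=> fl r; under eq_set do rewrite -ltrBlDr; exact: fl. Qed.

Lemma lsc_indic (G : set T) : open G -> lsc (\1_G : T -> R).
Proof.
move=> oG r; have [r0|r0] := ltP r 0.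
  rewrite (_ : [set _ | _] = setT); first exact: openT.
  by apply/seteqP; split => x //= _; rewrite (lt_le_trans r0).
have [r1|r1] := ltP r 1.
  rewrite (_ : [set _ | _] = G) //; apply/seteqP; split => x /=; rewrite indicE.
    by case: (boolP (x \in G)) => [/set_mem//|_]; rewrite /= ltNge r0.
  by move=> Gx; rewrite mem_set.
rewrite (_ : [set _ | _] = set0); first exact: open0.
apply/seteqP; split => x //=; rewrite indicE.
by case: (x \in G) => /=; rewrite ltNge ?r1// r0.
Qed.

(* The Pasch-Hausdorff envelopes x |-> inf_y (min (f y) n + n d(x,y)). *)
Lemma lsc_approximation (d : T -> T -> R) f : metrized_by d ->
  lsc f -> (forall x, 0 <= f x) ->
  exists g : nat -> T -> R,
    [/\ forall n, continuous (g n),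
        forall n x, 0 <= g n x <= n%:R,
        forall m n x, (m <= n)%N -> g m x <= g n x,
        forall n x, g n x <= f x &
        forall x, g ^~ x @ \oo --> f x].
Proof.
move=> [d0 dge0 dC dD dnbhs] fl f0.
pose E n x := [set Num.min (f y) n%:R + n%:R * d x y | y in [set: T]].
pose g n x := inf (E n x).
have E0 n x : (E n x) !=set0 by exists (Num.min (f x) n%:R + n%:R * d x x), x.
have lbE n x : lbound (E n x) 0.
  by move=> _ [y _ <-]; rewrite addr_ge0// ?mulr_ge0// le_min f0/=.
have hlE n x : has_lbound (E n x) by exists 0; exact: lbE.
have gle n x y : g n x <= Num.min (f y) n%:R + n%:R * d x y.
  by apply: ge_inf => //; exists y.
have lip n x y : g n x <= g n y + n%:R * d x y.
  rewrite -lerBlDr; apply: lb_le_inf => // _ [z _ <-].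
  rewrite lerBlDr (le_trans (gle n x z))// -addrA lerD2l -mulrDr.
  by apply: ler_wpM2l => //; rewrite addrC dD.
have ndg m n x : (m <= n)%N -> g m x <= g n x.
  move=> mn; apply: lb_le_inf => // _ [z _ <-].
  apply: (le_trans (gle m x z)); apply: lerD; last first.
    by rewrite ler_wpM2r// ler_nat.
  by rewrite le_min !ge_min lexx/= ler_nat mn orbT.
have glef n x : g n x <= f x.
  by apply: (le_trans (gle n x x)); rewrite d0 mulr0 addr0 ge_min lexx.
exists g; split => //.
- move=> n x; apply/cvgrPdist_lt => e e0.
  (* [g n] is [n]-Lipschitz; dividing by [n.+1] also covers [n = 0]. *)
  have e1 : 0 < e / n.+1%:R by rewrite divr_gt0.
  have : nbhs x [set y | d x y < e / n.+1%:R] by apply/dnbhs; exists (e / n.+1%:R).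
  apply: filterS => y /=; rewrite ltr_pdivlMr// mulrC => dxy.
  have nd : n%:R * d x y < e.
    by apply: le_lt_trans dxy; rewrite ler_wpM2r// ler_nat.
  have := lip n x y; have := lip n y x; rewrite (dC y x) => h1 h2.
  by rewrite ltr_norml; apply/andP; split; lra.
- move=> n x; rewrite lb_le_inf//=.
  by apply: (le_trans (gle n x x)); rewrite d0 mulr0 addr0 ge_min lexx orbT.
- move=> x; apply/cvgrPdist_le => e e0.
  have /dnbhs[del del0 hdel] : nbhs x [set y | f x - e < f y].
    by apply: open_nbhs_nbhs; split; [exact: fl|rewrite /= ltrBlDr ltrDl].
  (* [N] serves both kinds of competitors [y]: within [del], truncating at [N >= f x] keeps the
     value above [f x - e]; farther away, the penalty [N * d x y] alone reaches [f x]. *)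
  have [N hN] : exists N : nat, f x <= N%:R /\ f x <= N%:R * del.
    exists (maxn (Num.truncn (f x)).+1 (Num.truncn (f x / del)).+1); split.
      apply: (le_trans (ltW (truncnS_gt _))).
      by rewrite ler_nat leq_max leqnn.
    rewrite -ler_pdivrMr//; apply: (le_trans (ltW (truncnS_gt _))).
    by rewrite ler_nat leq_max leqnn orbT.
  exists N => // n /= Nn; rewrite ger0_norm ?subr_ge0//.
  rewrite lerBlDl -lerBlDr; apply: le_trans (ndg _ _ _ Nn).
  apply: lb_le_inf => // _ [y _ <-]; have [fxN fxd] := hN.
  have [xy|xy] := ltP (d x y) del.
    apply: (@le_trans _ _ (Num.min (f y) N%:R)); last by rewrite lerDl mulr_ge0.
    by rewrite le_min (ltW (hdel _ xy))/=; lra.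
  have : N%:R * del <= N%:R * d x y by rewrite ler_wpM2l.
  have : 0 <= Num.min (f y) N%:R by rewrite le_min f0/=.
  lra.
Qed.

End lower_semicontinuity.

(** * Bounded continuous and bounded Borel functions *)

Section bounded_functions.
Context (R : realType) (T : ptopologicalType).
Implicit Types (f g : T -> R) (mu : probability (borel T) R).

Definition bounded_by_some f := exists M, forall x, `|f x| <= M.

Definition bcont f := continuous f /\ bounded_by_some f.

Definition bmeas f := measurable_fun setT (f : borel T -> R) /\
  bounded_by_some f.

Lemma bounded_by_someP f : bounded_by_some f <-> bounded_fun f.
Proof.
split=> [[M fM]|[M [_ fM]]]; last first.
  by exists (M + 1) => x; apply: fM => //; rewrite ltrDl.
exists M; split; first exact: num_real.
by move=> N MN x _ /=; apply: (le_trans (fM x)); exact: ltW.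
Qed.

Lemma bounded_itv f a b : (forall x, a <= f x <= b) -> bounded_by_some f.
Proof.
move=> h; exists (`|a| + `|b|) => x; have /andP[h1 h2] := h x.
have := ler_norm b; have := ler_norm (- a); rewrite normrN.
have := normr_ge0 a; have := normr_ge0 b; move=> *.
by rewrite ler_norml; apply/andP; split; lra.
Qed.

Lemma bounded_cst k : bounded_by_some (fun=> k).
Proof. by exists `|k|. Qed.

Lemma boundedD f g : bounded_by_some f -> bounded_by_some g ->
  bounded_by_some (fun x => f x + g x).
Proof.
move=> [M fM] [N gN]; exists (M + N) => x.
by rewrite (le_trans (ler_normD _ _))// lerD.
Qed.

Lemma boundedM f k : bounded_by_some f -> bounded_by_some (fun x => k * f x).
Proof.
by move=> [M fM]; exists (`|k| * M) => x; rewrite normrM ler_wpM2l.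
Qed.

Lemma bcont_cst k : bcont (fun=> k).
Proof. by split; [exact: cst_continuous|exact: bounded_cst]. Qed.

Lemma bcontD f g : bcont f -> bcont g -> bcont (fun x => f x + g x).
Proof.
move=> [fc fb] [gc gb]; split; last exact: boundedD.
by move=> x; apply: cvgD; [exact: fc|exact: gc].
Qed.

Lemma bcontM f k : bcont f -> bcont (fun x => k * f x).
Proof.
move=> [fc fb]; split; last exact: boundedM.
by move=> x; apply: cvgM; [exact: cvg_cst|exact: fc].
Qed.

Lemma bcont_sum (h : nat -> T -> R) n : (forall i, bcont (h i)) ->
  bcont (fun x => \sum_(i < n) h i x).
Proof.
move=> hb; elim: n => [|n ih].
  by under eq_fun do rewrite big_ord0; exact: bcont_cst.
by under eq_fun do rewrite big_ord_recr/=; exact: bcontD.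
Qed.

Lemma bcont_max f g : bcont f -> bcont g -> bcont (f \max g).
Proof.
move=> [fc [M fM]] [gc [N gN]]; split=> [x|].
  by apply: continuous_max; [exact: fc|exact: gc].
exists (Num.max M N) => x /=; rewrite le_max.
by rewrite /Num.max; case: ifPn => _; rewrite ?fM ?gN ?orbT.
Qed.

Lemma bcont_min f g : bcont f -> bcont g -> bcont (f \min g).
Proof.
move=> [fc [M fM]] [gc [N gN]]; split=> [x|].
  by apply: continuous_min; [exact: fc|exact: gc].
exists (Num.max M N) => x /=; rewrite le_max.
by rewrite /Num.min; case: ifPn => _; rewrite ?fM ?gN ?orbT.
Qed.

Lemma bcont_bmeas f : bcont f -> bmeas f.
Proof. by move=> [fc fb]; split => //; exact: continuous_borel_measurable. Qed.

Lemma bmeas_indic (G : set T) : open G -> bmeas (\1_G).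
Proof.
move=> oG; split; first by apply: lsc_measurable; exact: lsc_indic.
by apply: (@bounded_itv _ 0 1) => x; rewrite indicE ler0n lern1 leq_b1.
Qed.

Lemma bmeasD f g : bmeas f -> bmeas g -> bmeas (fun x => f x + g x).
Proof.
by move=> [fc fb] [gc gb]; split; [exact: measurable_funD|exact: boundedD].
Qed.

Lemma bmeas_cst k : bmeas (fun=> k).
Proof. by split; [exact: measurable_cst|exact: bounded_cst]. Qed.

Lemma bmeas_integrable mu f : bmeas f -> mu.-integrable setT (EFin \o f).
Proof.
move=> [fm /bounded_by_someP fb]; apply: measurable_bounded_integrable => //.
by apply: (le_lt_trans (probability_le1 mu measurableT)); exact: ltry.
Qed.

Lemma RintegralD_bmeas mu f g : bmeas f -> bmeas g ->
  \int[mu]_x (f x + g x) = \int[mu]_x f x + \int[mu]_x g x.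
Proof. by move=> fb gb; rewrite RintegralD//; exact: bmeas_integrable. Qed.

Lemma RintegralM_bmeas mu f k : bmeas f ->
  \int[mu]_x (k * f x) = k * \int[mu]_x f x.
Proof. by move=> fb; rewrite RintegralZl//; exact: bmeas_integrable. Qed.

Lemma le_Rintegral_bmeas mu f g : bmeas f -> bmeas g ->
  (forall x, f x <= g x) -> \int[mu]_x f x <= \int[mu]_x g x.
Proof. by move=> fb gb fg; apply: le_Rintegral => //; exact: bmeas_integrable. Qed.

Lemma Rintegral_prob_cst mu k : \int[mu]_x k = k.
Proof.
rewrite Rintegral_cst// [X in fine X](_ : _ = 1%E) ?mulr1//.
exact: probability_setT.
Qed.

Lemma Rintegral_open_indic mu (G : set T) : open G ->
  \int[mu]_x (\1_G x) = fine (mu G).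
Proof.
move=> oG; rewrite /Rintegral integral_indic ?setIT//.
exact: sub_sigma_algebra.
Qed.

Lemma bmeas_sum (h : nat -> T -> R) n : (forall i, bmeas (h i)) ->
  bmeas (fun x => \sum_(i < n) h i x).
Proof.
move=> hb; elim: n => [|n ih].
  by under eq_fun do rewrite big_ord0; exact: bmeas_cst.
by under eq_fun do rewrite big_ord_recr/=; exact: bmeasD.
Qed.

Lemma Rintegral_sum_bmeas mu (h : nat -> T -> R) n : (forall i, bmeas (h i)) ->
  \int[mu]_x (\sum_(i < n) h i x) = \sum_(i < n) \int[mu]_x h i x.
Proof.
move=> hb; elim: n => [|n ih].
  by under eq_Rintegral do rewrite big_ord0; rewrite Rintegral_prob_cst big_ord0.
under eq_Rintegral do rewrite big_ord_recr/=.
by rewrite RintegralD_bmeas// ?ih ?big_ord_recr//; exact: bmeas_sum.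
Qed.

End bounded_functions.

(** * Riesz representation *)

(** The last clause is Daniell's continuity along sequences increasing to [f]. It is phrased with
    [e] and an index rather than with a limit because the tightness estimate produces it in this
    form and countable subadditivity consumes it so. *)
Definition smooth_functional (R : realType) (T : ptopologicalType)
    (L : (T -> R) -> R) : Prop :=
  [/\ forall f g, bcont f -> bcont g -> L (fun x => f x + g x) = L f + L g,
      forall k f, bcont f -> L (fun x => k * f x) = k * L f,
      forall f g, bcont f -> bcont g -> (forall x, f x <= g x) -> L f <= L g,
      L (fun=> 1) = 1 &
      forall f (h : nat -> T -> R), bcont f -> (forall n, bcont (h n)) ->
        (forall n x, 0 <= h n x <= f x) ->
        (forall m n x, (m <= n)%N -> h m x <= h n x) ->
        (forall x e, 0 < e -> exists n, f x - e <= h n x) ->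
        forall e, 0 < e -> exists n, L f - e <= L (h n)].

Section riesz.
Context (R : realType) (T : ptopologicalType) (d : T -> T -> R).
Hypothesis dT : metrized_by d.
Context (L : (T -> R) -> R).
Hypothesis hL : smooth_functional L.
Implicit Types (f g : T -> R) (G V E : set T).

Let LD f g : bcont f -> bcont g -> L (fun x => f x + g x) = L f + L g.
Proof. by have [+ _ _ _ _] := hL; exact. Qed.
Let LM k f : bcont f -> L (fun x => k * f x) = k * L f.
Proof. by have [_ + _ _ _] := hL; exact. Qed.
Let Lle f g : bcont f -> bcont g -> (forall x, f x <= g x) -> L f <= L g.
Proof. by have [_ _ + _ _] := hL; exact. Qed.
Let L1 : L (fun=> 1) = 1.
Proof. by have [_ _ _ + _] := hL. Qed.

Let Lcst k : L (fun=> k) = k.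
Proof.
rewrite -[LHS](_ : L (fun=> k * 1) = _); last first.
  by congr L; apply/funext => x; rewrite mulr1.
by rewrite (LM _ (bcont_cst T 1)) L1 mulr1.
Qed.

Let Lsum (h : nat -> T -> R) n : (forall i, bcont (h i)) ->
  L (fun x => \sum_(i < n) h i x) = \sum_(i < n) L (h i).
Proof.
move=> hb; elim: n => [|n ih].
  by under eq_fun do rewrite big_ord0; rewrite Lcst big_ord0.
under eq_fun do rewrite big_ord_recr/=.
by rewrite LD// ?ih ?big_ord_recr//; exact: bcont_sum.
Qed.

Let below G f := bcont f /\ forall x, 0 <= f x <= \1_G x.

Let below_le1 G f x : below G f -> f x <= 1.
Proof. by move=> [_ /(_ x)/andP[_ /le_trans]]; apply; rewrite indicE lern1 leq_b1. Qed.

Let below_out G f x : below G f -> ~ G x -> f x = 0.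
Proof.
move=> [_ /(_ x)/andP[f0 f1]] Gx; apply/eqP; rewrite eq_le f0 andbT.
by rewrite (le_trans f1)// indicE memNset.
Qed.

Let belowI G f : bcont f -> (forall x, 0 <= f x <= 1) ->
  (forall x, ~ G x -> f x = 0) -> below G f.
Proof.
move=> fb f01 fG; split=> // x; have /andP[-> f1]/= := f01 x; rewrite indicE.
have [//|/negP Gx] := boolP (x \in G); rewrite fG// => Gx'.
by apply: Gx; rewrite inE.
Qed.

Let below_L01 G f : below G f -> 0 <= L f <= 1.
Proof.
move=> fG; have [fb f01] := fG; apply/andP; split.
  rewrite -[leLHS]Lcst; apply: Lle => //; first exact: bcont_cst.
  by move=> x; case/andP: (f01 x).
rewrite -[leRHS]L1; apply: Lle => // [|x]; first exact: bcont_cst.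
exact: below_le1 fG.
Qed.

(** The mass that a measure representing [L] must give to an open set; the other sets are reached
    through [outer]. *)
Let content G := sup [set L f | f in below G].

Let below0 G : below G (fun=> 0).
Proof. by split; [exact: bcont_cst|move=> x; rewrite lexx indicE ler0n]. Qed.

Let L_content G f : below G f -> L f <= content G.
Proof.
move=> fG; apply: ub_le_sup; last by exists f.
by exists 1 => _ [g /below_L01/andP[_ ?] <-].
Qed.

Let content_le G r : (forall f, below G f -> L f <= r) -> content G <= r.
Proof.
move=> h; apply: ge_sup => [|_ [f fG <-]]; last exact: h.
by exists (L (fun=> 0)), (fun=> 0).
Qed.

Let content_ge0 G : 0 <= content G.
Proof. by rewrite -(Lcst 0); exact: L_content. Qed.

Let content_le1 G : content G <= 1.
Proof. by apply: content_le => f /below_L01/andP[]. Qed.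

Let content_mono G V : G `<=` V -> content G <= content V.
Proof.
move=> GV; apply: content_le => f fG; apply: L_content.
have [fb f01] := fG; apply: belowI => // [x|x Vx].
  by case/andP: (f01 x) => -> _; rewrite (below_le1 _ fG).
by apply: below_out fG _ => /GV.
Qed.

Let content_adherent G e : 0 < e -> exists2 f, below G f & content G - e <= L f.
Proof.
move=> e0; have [|_ [f fG <-] h] := @sup_adherent _ [set L f | f in below G] e e0.
  split; first by exists (L (fun=> 0)), (fun=> 0).
  by exists 1 => _ [g /below_L01/andP[_ ?] <-].
by exists f => //; exact: ltW.
Qed.

(* f <= 1_(\bigcup_n G n) is the increasing limit of f \min \sum_(n < k) h n k,
   where h n k increases to 1_(G n) with k. *)
Let content_sigma_subadditive (G : nat -> set T) : (forall n, open (G n)) ->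
  ((content (\bigcup_n G n))%:E <= \sum_(n <oo) (content (G n))%:E)%E.
Proof.
move=> oG; set S := (X in (_ <= X)%E).
have S0 : (0 <= S)%E by apply: nneseries_ge0 => n _ _; rewrite lee_fin.
have [->|Sy] := eqVneq S +oo%E; first exact: leey.
have Sfin : S \is a fin_num by rewrite ge0_fin_numE// lt_neqAle Sy leey.
rewrite -(fineK Sfin) lee_fin; apply: content_le => f fG.
have [fb f01] := fG.
have /choice[h hP] : forall n, exists g : nat -> T -> R,
    [/\ forall n, continuous (g n),
        forall n x, 0 <= g n x <= n%:R,
        forall m n x, (m <= n)%N -> g m x <= g n x,
        forall m x, g m x <= \1_(G n) x &
        forall x, g ^~ x @ \oo --> (\1_(G n) x : R)].
  move=> n; apply: (lsc_approximation dT) => [|x]; first exact: lsc_indic.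
  by rewrite indicE ler0n.
have hb n k : bcont (h n k).
  have [hc h0 _ _ _] := hP n; split; first exact: hc.
  exact: bounded_itv (h0 k).
have h0 n k x : 0 <= h n k x by have [_ + _ _ _] := hP n; move=> /(_ k x)/andP[].
have hbelow n k : below (G n) (h n k).
  by split=> // x; rewrite h0/=; have [_ _ _ + _] := hP n; exact.
pose s k x := \sum_(n < k) h n k x.
have sb k : bcont (s k) by exact: (bcont_sum k (fun n => hb n k)).
apply/ler_addgt0Pr => e e0.
have [_ _ _ _ /(_ f (fun k => f \min s k) fb (fun k => bcont_min fb (sb k)))] := hL.
case/(_ _ _ _ e e0) => [n x|m n x mn|x eps eps0|k].
- rewrite /= ge_min lexx/= andbT le_min; case/andP: (f01 x) => -> _.
  by rewrite sumr_ge0.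
- rewrite /= le_min !ge_min lexx/=; apply/orP; right.
  rewrite /s (big_ord_widen n (fun i => h i m x))// big_mkcond/=.
  apply: ler_sum => i _; case: ifPn => // _.
  by have [_ _ + _ _] := hP i; exact.
- have [[n _ Gnx]|nG] := pselect ((\bigcup_n G n) x).
    have [_ _ hnd _ /(_ x)] := hP n; rewrite indicE mem_set//= => /cvgrPdist_le.
    move=> /(_ _ eps0)[N _ /(_ (maxn N n.+1))]/=; rewrite leq_maxl => /(_ isT) hN.
    (* An index above [n] makes [h n] a summand of [s]; an index at least [N] brings [h n] within
       [eps] of 1, which bounds [f x]. *)
    exists (maxn N n.+1); rewrite le_min lerBlDr lerDl ltW//=.
    have fx1 := below_le1 x fG.
    apply: (@le_trans _ _ (h n (maxn N n.+1) x)).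
      by move: hN => /ler_normlP[]; lra.
    have nN : (n < maxn N n.+1)%N by rewrite leq_max leqnn orbT.
    by rewrite /s (bigD1 (Ordinal nN))//= lerDl sumr_ge0.
  exists 0%N; rewrite /= /s big_ord0 (below_out fG nG) minxx sub0r.
  by rewrite oppr_le0 ltW.
- move=> hk; rewrite -lerBlDr; apply: (le_trans hk).
  apply: (@le_trans _ _ (L (s k))).
    by apply: Lle => [|//|x]; [exact: bcont_min|rewrite /= ge_min lexx orbT].
  have -> : L (s k) = \sum_(n < k) L (h n k) by exact: (Lsum k (fun n => hb n k)).
  apply: (@le_trans _ _ (\sum_(n < k) content (G n))).
    by apply: ler_sum => n _; exact: L_content.
  rewrite -lee_fin fineK// -sumEFin -(big_mkord xpredT (fun n => (content (G n))%:E)).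
  by apply: nneseries_lim_ge => n _ _; rewrite lee_fin.
Qed.

(** A real infimum is enough: contents lie between 0 and 1, and [setT] is always a candidate. *)
Let outer E := (inf [set content G | G in [set G | open G /\ E `<=` G]])%:E.

Let outer_lb E : has_lbound [set content G | G in [set G | open G /\ E `<=` G]].
Proof. by exists 0 => _ [G _ <-]. Qed.

Let outer_le E G : open G -> E `<=` G -> (outer E <= (content G)%:E)%E.
Proof.
move=> oG EG; rewrite lee_fin; apply: ge_inf; first exact: outer_lb.
by exists G.
Qed.

Let outer_ge E r : (forall G, open G -> E `<=` G -> r <= content G) ->
  (r%:E <= outer E)%E.
Proof.
move=> h; rewrite lee_fin; apply: lb_le_inf => [|_ [G [oG EG] <-]]; last exact: h.
by exists (content setT), setT => //; split => //; exact: openT.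
Qed.

Let outer_adherent E e : 0 < e -> exists2 G, open G /\ E `<=` G &
  ((content G)%:E <= outer E + e%:E)%E.
Proof.
move=> e0; have [|_ [G [oG EG] <-] h] :=
    @inf_adherent _ [set content G | G in [set G | open G /\ E `<=` G]] e e0.
  split; last exact: outer_lb.
  by exists (content setT), setT => //; split => //; exact: openT.
by exists G => //; rewrite -EFinD lee_fin ltW.
Qed.

Let outer_open G : open G -> outer G = (content G)%:E.
Proof.
move=> oG; apply/eqP; rewrite eq_le outer_le//=.
by apply: outer_ge => V _; exact: content_mono.
Qed.

Let outer_ge0 E : (0 <= outer E)%E.
Proof. exact: outer_ge. Qed.

Let outer0 : outer set0 = 0%E.
Proof.
rewrite outer_open; last exact: open0.
congr EFin; apply/eqP; rewrite eq_le content_ge0 andbT; apply: content_le => f f0.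
rewrite (_ : f = fun=> 0) ?Lcst//; apply/funext => x.
exact: below_out f0 _.
Qed.

Let outer_mono : {homo outer : E V / E `<=` V >-> (E <= V)%E}.
Proof.
move=> E V EV; apply: outer_ge => G oG VG; rewrite -lee_fin; apply: outer_le => //.
exact: subset_trans VG.
Qed.

Let outer_sigma_subadditive : sigma_subadditive outer.
Proof.
move=> F; apply/lee_addgt0Pr => e e0.
have /choice[G GP] : forall n, exists G, [/\ open G, F n `<=` G &
    ((content G)%:E <= outer (F n) + (e / (2 ^ n.+1)%:R)%:E)%E].
  move=> n; have [|G [oG FG] h] := @outer_adherent (F n) (e / (2 ^ n.+1)%:R).
    by rewrite divr_gt0// ltr0n expn_gt0.
  by exists G; split.
apply: (@le_trans _ _ (content (\bigcup_n G n))%:E).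
  apply: outer_le; first by apply: bigcup_open => n _; have [] := GP n.
  by apply: subset_bigcup => n _; have [] := GP n.
apply: (@le_trans _ _ (\sum_(n <oo) (content (G n))%:E)%E).
  by apply: content_sigma_subadditive => n; have [] := GP n.
apply: le_trans (epsilon_trick xpredT (fun n => outer_ge0 (F n)) (ltW e0)).
apply: lee_nneseries => [n _ _|n _]; first by rewrite lee_fin.
by have [] := GP n.
Qed.

Let outerM : {outer_measure set T -> \bar R} := HB.pack outer
  (isOuterMeasure.Build R T outer outer0 outer_ge0 outer_mono
    outer_sigma_subadditive).

(* Test [caratheodory_measurable] on open V: if f <= 1_(V `&` G) nearly attains
   the content and g <= 1_W with W = V `&` [f < e/2], then
   (f - e/2)^+ + g <= 1_V. *)
Let outer_caratheodory G : open G -> caratheodory_measurable outer G.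
Proof.
move=> oG.
suff : outerM.-caratheodory G by [].
apply: le_caratheodory_measurable => X; rewrite /outerM/=.
rewrite -[leLHS]/(_ + _)%E /outer -EFinD; apply: outer_ge => V oV XV.
apply: (@le_trans _ _ (fine (outer (V `&` G) + outer (V `&` ~` G)))).
  rewrite -lee_fin EFinD fineK//.
  by apply: leeD; apply: outer_mono; exact: setSI.
rewrite outer_open; last exact: openI.
apply/ler_addgt0Pr => e e0; have e20 : 0 < e / 2 by rewrite divr_gt0.
have [f fVG Lf] := content_adherent (V `&` G) e20; have [[fc fb] f01] := fVG.
pose W := V `&` [set x | f x < e / 2].
have oW : open W.
  apply: openI => //; rewrite -preimage_itvNyo.
  by apply: open_comp => [x _|]; [exact: fc|exact: interval_open].
have VW : V `&` ~` G `<=` W.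
  move=> x [Vx Gx]; split => //=; rewrite (below_out fVG)// => -[_ //].
have h1 : content W <= content V - L f + e / 2.
  apply: content_le => g gW; have [gb g01] := gW.
  pose f' := (fun x => f x + - (e / 2)) \max (fun=> 0).
  have f'b : bcont f' by apply: bcont_max; [apply: bcontD => //|]; exact: bcont_cst.
  have : L f + - (e / 2) <= L f'.
    rewrite -[X in _ + X]Lcst -LD//; last exact: bcont_cst.
    apply: Lle => //; first by apply: bcontD => //; exact: bcont_cst.
    by move=> x; rewrite /f'/= le_max lexx.
  have : L f' + L g <= content V.
    rewrite -LD//; apply: L_content; apply: belowI; first exact: bcontD.
      move=> x; have [Wx|Wx] := pselect (W x).
        rewrite (_ : f' x = 0) ?add0r ?(below_le1 _ gW)//.
          by case/andP: (g01 x) => ->.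
        by rewrite /f' /= max_r// subr_le0 ltW//; case: Wx.
      rewrite (below_out gW)// addr0 /f'/= le_max lexx orbT/= ge_max ler01 andbT.
      by rewrite (le_trans _ (below_le1 x fVG))// lerBlDr lerDl ltW.
    move=> x Vx; rewrite (below_out gW); last by case.
    rewrite /f'/= (below_out fVG); last by case.
    by rewrite addr0 max_r// sub0r oppr_le0 ltW.
  lra.
have h2 : fine (outer (V `&` ~` G)) <= content W.
  by rewrite -lee_fin fineK//; exact: outer_le.
rewrite fineD//=; move: h1 h2; rewrite /outer/=; lra.
Qed.

Let borel_caratheodory (E : set (borel T)) : measurable E ->
  caratheodory_measurable outer E.
Proof.
suff : @measurable _ (borel T) `<=` outerM.-caratheodory by exact.
apply: smallest_sub; last by move=> G oG; exact: outer_caratheodory.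
split.
- exact: caratheodory_measurable_set0.
- by move=> A mA; rewrite setTD; exact: caratheodory_measurable_setC.
- by move=> A mA; exact: caratheodory_measurable_bigcup.
Qed.

Let outer_semi_sigma_additive :
  semi_sigma_additive (outer : set (borel T) -> \bar R).
Proof.
move=> A mA tA mbigA; apply: (@caratheodory_measure_sigma_additive R T outerM) => //.
- by move=> i; exact: borel_caratheodory.
- exact: borel_caratheodory.
Qed.

Let outer_measure : {measure set (borel T) -> \bar R} := HB.pack
  (outer : set (borel T) -> \bar R)
  (isMeasure.Build _ (borel T) R (outer : set (borel T) -> \bar R)
    outer0 outer_ge0 outer_semi_sigma_additive).

Let outer_measure_setT : outer_measure setT = 1%E.
Proof.
rewrite /outer_measure/= outer_open; last exact: openT.
congr EFin; apply/eqP; rewrite eq_le content_le1/= -[leLHS]L1.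
apply: L_content; apply: belowI => [|x|x /(_ I)//]; first exact: bcont_cst.
by rewrite ler01 lexx.
Qed.

Let mu : probability (borel T) R := HB.pack
  (outer : set (borel T) -> \bar R)
  (isMeasure.Build _ (borel T) R (outer : set (borel T) -> \bar R)
    outer0 outer_ge0 outer_semi_sigma_additive)
  (Measure_isProbability.Build _ (borel T) R outer_measure outer_measure_setT).

Let mu_open G : open G -> mu G = (content G)%:E.
Proof. by move=> oG; rewrite /mu/= outer_open. Qed.

Let clamp (k : nat) (y : R) := Num.max (Num.min (y - k%:R) 1) 0.

(** [clamp k y] is the part of [y] between the heights [k] and [k + 1], so the slices stack up to
    [y] cut at [n]. *)
Let sum_clamp n y : 0 <= y -> \sum_(k < n) clamp k y = Num.min y n%:R.
Proof.
move=> y0; elim: n => [|n ih]; first by rewrite big_ord0 min_r.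
rewrite big_ord_recr/= ih /clamp -natr1.
have [h|h] := leP y n%:R.
  by rewrite [in X in _ + X]max_r ?ge_min ?subr_le0 ?h// addr0 min_l//; lra.
rewrite [X in _ + X]max_l ?le_min ?ler01 ?subr_ge0 ?(ltW h)//.
have [h1|h1] := leP (y - n%:R) 1; have [h2|h2] := leP y (n%:R + 1); lra.
Qed.

(* Layer cake: n f is the sum over k < n of clamp k (n f), and clamp k (n f)
   is at most the indicator of [k < n f]. *)
Let le_L_Rintegral_itv f : bcont f -> (forall x, 0 <= f x <= 1) ->
  L f <= \int[mu]_x f x.
Proof.
move=> fb f01; apply/ler_addgt0Pr => e e0.
(* After scaling by [n] the layer-cake comparison loses at most 1, that is [1 / n <= e] before
   scaling. *)
pose n := (Num.truncn e^-1).+1; have n0 : 0 < n%:R :> R by rewrite ltr0n.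
have ne : 1 <= n%:R * e.
  by rewrite -ler_pdivrMr// mul1r ltW// truncnS_gt.
have nf x : 0 <= n%:R * f x <= n%:R.
  by case/andP: (f01 x) => f0 f1; rewrite mulr_ge0//= ger_pMr.
pose G (k : nat) := [set x | k%:R < n%:R * f x].
have nfb : bcont (fun x => n%:R * f x) by exact: bcontM.
have oG k : open (G k) by apply: continuous_lsc; case: nfb.
pose phi k x := clamp k (n%:R * f x).
have phib k : bcont (phi k).
  apply: (@bcont_max _ _ ((fun x => n%:R * f x + - k%:R) \min (fun=> 1)));
    last exact: bcont_cst.
  by apply: bcont_min; [apply: bcontD => //|]; exact: bcont_cst.
have phiG k : below (G k) (phi k).
  apply: belowI => // x; rewrite /phi /clamp.
    by rewrite le_max lexx orbT/= ge_max ler01 ge_min lexx orbT.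
  by move=> /negP; rewrite -leNgt => h; rewrite max_r// ge_min subr_le0 h.
have h1 : n%:R * L f <= \sum_(k < n) \int[mu]_x \1_(G k) x.
  rewrite -LM// (_ : (fun x => _) = fun x => \sum_(k < n) phi k x); last first.
    apply/funext => x; rewrite sum_clamp; last by case/andP: (nf x).
    by rewrite min_l//; case/andP: (nf x).
  rewrite Lsum//; apply: ler_sum => k _.
  by rewrite Rintegral_open_indic// mu_open//=; exact: L_content.
have h2 : \sum_(k < n) \int[mu]_x \1_(G k) x <= n%:R * (\int[mu]_x f x) + 1.
  rewrite -(Rintegral_sum_bmeas _ (h := fun k => \1_(G k))); last first.
    by move=> k; exact: bmeas_indic.
  rewrite -RintegralM_bmeas; last exact: bcont_bmeas.
  rewrite -[X in _ <= _ + X](Rintegral_prob_cst mu) -RintegralD_bmeas; last 2 first.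
    exact: bcont_bmeas.
    exact: bmeas_cst.
  apply: le_Rintegral_bmeas.
  - by apply: (bmeas_sum n (h := fun k => \1_(G k))) => k; exact: bmeas_indic.
  - by apply: bmeasD; [exact: bcont_bmeas|exact: bmeas_cst].
  - move=> x; have /andP[nf0 nfn] := nf x.
    (* Where [n f > k], the slice of [n f + 1] above [k] is full; raising the function by one unit
       thus dominates every indicator. *)
    apply: (@le_trans _ _ (\sum_(k < n) clamp k (n%:R * f x + 1))).
      apply: ler_sum => k _; rewrite indicE /clamp.
      case: (boolP (x \in G k)) => [/set_mem Gx|_]; last by rewrite le_max lexx orbT.
      rewrite le_max le_min lexx andbT lerBrDr [1 + _]addrC lerD2r.
      by rewrite (ltW Gx).
    by rewrite sum_clamp ?addr_ge0// ge_min lexx.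
rewrite -(ler_pM2l n0) mulrDr; apply: (le_trans h1); apply: (le_trans h2).
by rewrite lerD2l.
Qed.

Let le_L_Rintegral f : bcont f -> L f <= \int[mu]_x f x.
Proof.
move=> fb; have [fc [M0 fM0]] := fb; pose M := `|M0| + 1.
have M_gt0 : 0 < M by rewrite ltr_wpDl.
have fM x : `|f x| <= M.
  by rewrite (le_trans (fM0 x))// (le_trans (ler_norm M0))// lerDl.
(* [k * (f + M)] takes values in the unit interval; the [+ 1] in [M] keeps it positive when the
   bound is 0. *)
pose k : R := (M + M)^-1; have k0 : 0 < k by rewrite invr_gt0 addr_gt0.
have gb : bcont (fun x => f x + M) by apply: bcontD => //; exact: bcont_cst.
have := @le_L_Rintegral_itv (fun x => k * (f x + M)) (bcontM k gb).
rewrite RintegralM_bmeas ?LM//; last exact: bcont_bmeas.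
rewrite RintegralD_bmeas; [|exact: bcont_bmeas|exact: bmeas_cst].
rewrite LD//; last exact: bcont_cst.
rewrite Lcst Rintegral_prob_cst ler_pM2l// lerD2r; apply => x.
have := fM x; rewrite ler_norml => /andP[h1 h2].
apply/andP; split; first by apply: mulr_ge0; [exact: ltW|lra].
have kM : k * (M + M) = 1 by rewrite mulVf// gt_eqF// addr_gt0.
by rewrite -kM; apply: ler_wpM2l; [exact: ltW|lra].
Qed.

(** The inequality [le_L_Rintegral], applied to [f] and to its opposite, gives equality. *)
Lemma riesz_representation : exists mu : probability (borel T) R,
  forall f, bcont f -> \int[mu]_x f x = L f.
Proof.
exists mu => f fb; apply/eqP; rewrite eq_le le_L_Rintegral// andbT.
have := le_L_Rintegral (bcontM (-1) fb).
rewrite LM// RintegralM_bmeas; last exact: bcont_bmeas.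
by rewrite !mulN1r lerN2.
Qed.

End riesz.

(** * Weak compactness *)

Section weak_topology.
Context (R : realType) (T : ptopologicalType).
Implicit Types (f : T -> R) (mu p : probability (borel T) R).

Lemma continuous_weak_Rintegral f : bcont f ->
  continuous (fun p : probability (borel T) R => \int[p]_x f x).
Proof.
move=> [fc /bounded_by_someP fb].
pose F : bounded_continuous R T := exist _ f (conj fc fb).
move=> p; apply: (@continuous_comp _ _ _ (@weak_evaluation R T) (@proj _ (fun=> R) F)).
  exact: initial_continuous.
exact: proj_continuous.
Qed.

Lemma weak_cvg (U : set_system (probability (borel T) R)) (FU : Filter U) mu :
  (forall f, bcont f ->
    \int[(p : probability (borel T) R)]_x f x @[p --> U] --> \int[mu]_x f x) ->
  U --> mu.
Proof.
move=> h W [B [[V oV <-] Vmu VW]].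
have UV : (@weak_evaluation R T @ U) --> (weak_evaluation mu : {ptws _ -> _}).
  (* The pointwise topology is a supremum of topologies pulled back along coordinates, so
     convergence is checked one test function at a time. Constant families show that each coordinate
     map is onto, as [cvg_image] demands. *)
  apply/cvg_sup => F; apply/cvg_image.
    by rewrite eqEsubset; split=> v // _; exists (cst v).
  have [fc /bounded_by_someP fb] := svalP F.
  have := h (sval F) (conj fc fb).
  move=> hF Q /hF/= UQ; exists ((@^~ F) @^-1` Q) => //.
  by rewrite eqEsubset; split => [j [? + <-//]|j Qj]; exists (fun=> j).
have : U (@weak_evaluation R T @^-1` V) by apply: UV; exact: open_nbhs_nbhs.
by apply: filterS.
Qed.

Section lsc_integral.
Context (d : T -> T -> R).
Hypothesis dT : metrized_by d.

(** Monotone convergence along the continuous approximations from below: if all their integrals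
    stayed at most [l], so would that of [f]. *)
Lemma lsc_integral_adherent f p (l : R) : lsc f -> (forall x, 0 <= f x) ->
  (l%:E < \int[p]_x (f x)%:E)%E ->
  exists g, [/\ bcont g, forall x, 0 <= g x <= f x & l < \int[p]_x g x].
Proof.
move=> fl f0 lf; have [g [gc g0n gnd gf gcvg]] := lsc_approximation dT fl f0.
have gb n : bcont (g n) by split; [exact: gc|exact: bounded_itv (g0n n)].
have g0 n x : 0 <= g n x by case/andP: (g0n n x).
have gm n : measurable_fun setT (fun x : borel T => (g n x)%:E).
  by apply/measurable_EFinP; case: (bcont_bmeas (gb n)).
have [n ln] : exists n, l < \int[p]_x g n x.
  apply: contrapT => /forallNP h; move: lf; apply/negP; rewrite -leNgt.
  have -> : (\int[p]_x (f x)%:E = \int[p]_x (limn (fun n => (g n x)%:E)))%E.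
    apply: eq_integral => x _; apply/esym/cvg_lim => //.
    by apply: cvg_EFin; [exact: nearW|exact: gcvg].
  rewrite monotone_convergence//.
  - apply: lime_le.
      apply: ereal_nondecreasing_is_cvgn => m n mn; apply: ge0_le_integral => // x _.
        by rewrite lee_fin.
      by rewrite lee_fin gnd.
    apply: nearW => n; have /negP := h n; rewrite -leNgt.
    rewrite -lee_fin /Rintegral fineK//.
    exact: integrable_fin_num (bmeas_integrable _ (bcont_bmeas (gb n))).
  - by move=> n x _; rewrite lee_fin.
  - by move=> x _ m n mn; rewrite lee_fin gnd.
by exists (g n); split => // x; rewrite g0 gf.
Qed.

(** The complement is open: a continuous minorant [g] of [f] whose integral at [p] exceeds [l] keeps
    exceeding it near [p], and [f] dominates [g]. *)
Lemma closed_lsc_integral_le f (l : R) : lsc f -> (forall x, 0 <= f x) ->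
  closed [set p : probability (borel T) R | (\int[p]_x (f x)%:E <= l%:E)%E].
Proof.
move=> fl f0; rewrite -[X in closed X]setCK; apply: open_closedC.
rewrite openE => p /= /negP; rewrite -ltNge => lf.
have [g [gb g0f lg]] := lsc_integral_adherent fl f0 lf.
have := @continuous_weak_Rintegral g gb p => /cvgr_gt/(_ l lg).
apply: filterS => q lq; apply/negP; rewrite -ltNge.
apply: (@lt_le_trans _ _ (\int[q]_x g x)%:E); first by rewrite lte_fin.
have gm : measurable_fun setT (fun x : borel T => (g x)%:E).
  by apply/measurable_EFinP; case: (bcont_bmeas gb).
have fm : measurable_fun setT (fun x : borel T => (f x)%:E).
  by apply/measurable_EFinP; exact: lsc_measurable.
rewrite /Rintegral fineK; last first.
  exact: integrable_fin_num (bmeas_integrable _ (bcont_bmeas gb)).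
by apply: ge0_le_integral => // x _; rewrite lee_fin//; case/andP: (g0f x).
Qed.

End lsc_integral.
End weak_topology.

(** * Tightness from an inf-compact integrand *)

Section tightness.
Context (R : realType) (T : ptopologicalType) (d : T -> T -> R).
Hypothesis dT : metrized_by d.
Implicit Types (f h : T -> R) (p mu : probability (borel T) R).

Lemma bcont_Rintegral_bound f M p : bcont f -> (forall x, `|f x| <= M) ->
  - M <= \int[p]_x f x <= M.
Proof.
move=> fb fM; apply/andP; split.
  rewrite -[leLHS](Rintegral_prob_cst p); apply: le_Rintegral_bmeas.
  - exact: bmeas_cst.
  - exact: bcont_bmeas.
  - by move=> x; move: (fM x); rewrite ler_norml => /andP[].
rewrite -[leRHS](Rintegral_prob_cst p); apply: le_Rintegral_bmeas.
- exact: bcont_bmeas.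
- exact: bmeas_cst.
- by move=> x; move: (fM x); rewrite ler_norml => /andP[].
Qed.

(** Compactness of the segment gives a cluster point, and a cluster point of an ultrafilter is a
    limit. *)
Lemma ultra_cvg_bounded (S : Type) (U : set_system S) (u : S -> R) (M : R) :
  UltraFilter U -> (forall s, - M <= u s <= M) -> cvg (u @ U).
Proof.
move=> UU uM; have [|l [_ lcl]] := @segment_compact R (- M) M (u @ U) _.
  by apply: (@filterS _ U _ setT) filterT => s _ /=; rewrite in_itv/=; exact: uM.
apply/cvg_ex; exists l => V Vl.
have [//|UV] := in_ultra_setVsetC (u @^-1` V) UU.
have [x [/= nVx Vx]] := lcl (~` V) V UV Vl.
by case: nVx.
Qed.

(** Dini's argument: the open sets [V n] increase with [n] and cover [C], so the largest index of a
    finite subcover works on all of [C]. *)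
Lemma monotone_near_compact (C : set T) f (h : nat -> T -> R) e :
  compact C -> continuous f -> (forall n, continuous (h n)) ->
  (forall m n x, (m <= n)%N -> h m x <= h n x) -> 0 < e ->
  (forall x, exists n, f x - e < h n x) ->
  exists n, forall x, C x -> f x - e < h n x.
Proof.
move=> cC fc hc hnd e0 hf.
pose V n := [set x | 0 < h n x + (- f x + e)].
have VE n x : V n x <-> f x - e < h n x.
  by rewrite /V/= addrA addrAC -opprB opprD opprK; split; lra.
move: cC; rewrite compact_cover => /(_ nat setT V)[n _|x _|D _ CD].
- apply: continuous_lsc => x; apply: cvgD; first exact: hc.
  by apply: cvgD; [apply: cvgN; exact: fc|exact: cvg_cst].
- by have [n hn] := hf x; exists n => //; exact/VE.
- exists (\max_(i <- finmap.enum_fset D) i)%N => x /CD[i iD /VE]/lt_le_trans; apply.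
  by apply: hnd; apply: leq_bigmax_seq => //; exact: iD.
Qed.

(* Off the compact set [F <= l] one has f <= B <= (B/l) F. *)
Lemma tight_Rintegral_le (F : T -> R) f (h : nat -> T -> R) (M e : R) :
  (forall x, 0 <= F x) -> measurable_fun setT (F : borel T -> R) ->
  inf_compact (fun x => (F x)%:E) ->
  bcont f -> (forall n, bcont (h n)) -> (forall n x, 0 <= h n x <= f x) ->
  (forall m n x, (m <= n)%N -> h m x <= h n x) ->
  (forall x e, 0 < e -> exists n, f x - e <= h n x) -> 0 < e ->
  exists n, forall p : probability (borel T) R,
    (\int[p]_x (F x)%:E <= M%:E)%E -> \int[p]_x f x - e <= \int[p]_x h n x.
Proof.
move=> F0 mF iF fb hb h0f hnd hf e0.
have [_ [B0 fB0]] := fb; pose B := `|B0| + 1.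
have B_gt0 : 0 < B by rewrite ltr_wpDl.
have fB x : f x <= B.
  apply: (le_trans (ler_norm _)); apply: (le_trans (fB0 x)).
  by apply: (le_trans (ler_norm _)); rewrite lerDl.
pose M' := `|M| + 1; have M'_gt0 : 0 < M' by rewrite ltr_wpDl.
(* One half of [e] pays for Dini on the sublevel set of level [B / k], the other for [k * M]; [M']
   is a positive substitute for [M], whose sign is unknown. *)
pose k := e / 2 / M'; have k0 : 0 < k by rewrite !divr_gt0.
have e20 : 0 < e / 2 by rewrite divr_gt0.
have [n hn] : exists n, forall x, F x <= B / k -> f x - e / 2 < h n x.
  have := @monotone_near_compact [set x | ((F x)%:E <= (B / k)%:E)%E] f h (e / 2)
    (iF _) (proj1 fb) (fun n => proj1 (hb n)) hnd e20.
  case=> [x|n hn]; last by exists n => x Fx; apply: hn; rewrite /= lee_fin.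
  have [n hn] := hf x (e / 4) ltac:(lra).
  by exists n; apply: lt_le_trans hn; lra.
exists n => p Fp.
have fle x : f x <= h n x + e / 2 + k * F x.
  have [/hn|FB] := leP (F x) (B / k).
    have : 0 <= k * F x by rewrite mulr_ge0// ltW.
    lra.
  have : B < k * F x by rewrite mulrC -ltr_pdivrMr.
  by have := fB x; have /andP[] := h0f n x; lra.
have f0 x : 0 <= f x by have /andP[] := h0f n x; exact: le_trans.
have h0 x : 0 <= h n x by have /andP[] := h0f n x.
have mf : measurable_fun setT (fun x : borel T => (f x)%:E).
  by apply/measurable_EFinP; case: (bcont_bmeas fb).
have mh : measurable_fun setT (fun x : borel T => (h n x)%:E).
  by apply/measurable_EFinP; case: (bcont_bmeas (hb n)).
have mFE : measurable_fun setT (fun x : borel T => (F x)%:E) by exact/measurable_EFinP.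
have : (\int[p]_x (f x)%:E <=
    \int[p]_x ((h n x)%:E + (e / 2)%:E + k%:E * (F x)%:E))%E.
  apply: ge0_le_integral => //.
  - by move=> x _; rewrite lee_fin.
  - apply: emeasurable_funD; first by apply: emeasurable_funD.
    exact: measurable_funeM.
  - by move=> x _; rewrite -EFinM -!EFinD lee_fin.
rewrite ge0_integralD//; last 4 first.
- by move=> x _; rewrite -EFinD lee_fin addr_ge0// ltW.
- exact: emeasurable_funD.
- by move=> x _; rewrite -EFinM lee_fin mulr_ge0// ltW.
- exact: measurable_funeM.
rewrite ge0_integralD//; last 2 first.
- by move=> x _; rewrite lee_fin.
- by move=> x _; rewrite lee_fin ltW.
rewrite ge0_integralZl_EFin//; last 2 first.
- by move=> x _; rewrite lee_fin.
- exact: ltW.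
rewrite integral_cst// [X in (_ * X)%E](_ : _ = 1%E); last exact: probability_setT.
rewrite mule1.
have fin g : bcont g -> (\int[p]_x (g x)%:E)%E = (\int[p]_x g x)%:E.
  move=> gb; rewrite /Rintegral fineK//.
  exact: integrable_fin_num (bmeas_integrable _ (bcont_bmeas gb)).
rewrite (fin f)// (fin (h n))// => hle.
have : ((\int[p]_x f x)%:E <=
    (\int[p]_x h n x)%:E + (e / 2)%:E + k%:E * M%:E)%E.
  apply: (le_trans hle); apply: leeD => //; apply: lee_wpmul2l => //.
  by rewrite lee_fin ltW.
rewrite -EFinM -!EFinD !lee_fin.
have : k * M <= k * M'.
  rewrite ler_pM2l//; apply: (le_trans (ler_norm _)); by rewrite lerDl.
by rewrite {2}/k divfK ?gt_eqF//; lra.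
Qed.

Theorem prokhorov_ultra (F : T -> R) (M : R)
    (U : set_system (probability (borel T) R)) :
  (forall x, 0 <= F x) -> measurable_fun setT (F : borel T -> R) ->
  inf_compact (fun x => (F x)%:E) -> UltraFilter U ->
  U [set p : probability (borel T) R | (\int[p]_x (F x)%:E <= M%:E)%E] ->
  exists mu : probability (borel T) R, U --> mu.
Proof.
move=> F0 mF iF UU UM.
pose I f := fun p : probability (borel T) R => \int[p]_x f x.
have Icvg f : bcont f -> cvg (I f @ U).
  move=> fb; have [_ [M0 fM0]] := fb.
  by apply: (@ultra_cvg_bounded _ U (I f) M0) => p; exact: bcont_Rintegral_bound.
have [|mu Lmu] := @riesz_representation R T d dT (fun f => lim (I f @ U)).
  split.
  - move=> f g fb gb; apply/cvg_lim => //.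
    rewrite (_ : I _ = I f \+ I g).
      by apply: cvgD; exact: Icvg.
    by apply/funext => p; rewrite /I RintegralD_bmeas//; exact: bcont_bmeas.
  - move=> k f fb; apply/cvg_lim => //.
    rewrite (_ : I _ = fun p => k * I f p).
      by apply: cvgM; [exact: cvg_cst|exact: Icvg].
    by apply/funext => p; rewrite /I RintegralM_bmeas//; exact: bcont_bmeas.
  - move=> f g fb gb fg; apply: ler_lim; [exact: Icvg|exact: Icvg|].
    by apply: nearW => p; apply: le_Rintegral_bmeas => //; exact: bcont_bmeas.
  - apply/cvg_lim => //; rewrite (_ : I _ = cst 1); first exact: cvg_cst.
    by apply/funext => p; rewrite /I Rintegral_prob_cst.
  - move=> f h fb hb h0f hnd hf e e0.
    (* The index [n] is common to all [p] in the set, so the inequality survives the limit along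
       [U]; this uniformity makes the limit functional smooth. *)
    have [n hn] := @tight_Rintegral_le F f h M e F0 mF iF fb hb h0f hnd hf e0.
    exists n; rewrite lerBlDr.
    apply: (ler_cvg_to (f := I f) (g := fun p => I (h n) p + e) (a := U)).
    + exact: Icvg fb.
    + by apply: cvgD; [exact: Icvg (hb n)|exact: cvg_cst].
    + by apply: filterS UM => p /hn; rewrite lerBlDr.
exists mu; apply: weak_cvg => f fb; rewrite Lmu//; exact: Icvg.
Qed.

Theorem compact_inf_compact_integral_le (F : T -> R) (M : R) :
  (forall x, 0 <= F x) -> lsc F -> inf_compact (fun x => (F x)%:E) ->
  compact [set p : probability (borel T) R | (\int[p]_x (F x)%:E <= M%:E)%E].
Proof.
move=> F0 lF iF; rewrite compact_ultra => U UU UM.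
have [mu Umu] := prokhorov_ultra F0 (lsc_measurable lF) iF UU UM.
exists mu; split => //.
apply: (closed_lsc_integral_le dT lF F0) => V.
by move=> /Umu UV; exact: filter_ex (@filterI _ U _ _ _ UM UV).
Qed.

End tightness.

(** * Finite minimax *)

Section minimax_alternative.
Context (R : realType) (I : Type).
Implicit Types (C : set (I -> R)) (l : (I -> R) -> R).

Definition segment_point (t : R) (x y : I -> R) : I -> R :=
  fun i => t * x i + (1 - t) * y i.

Definition segment_closed C := forall t x y, 0 <= t <= 1 ->
  C x -> C y -> C (segment_point t x y).

Definition affine l := forall t x y,
  l (segment_point t x y) = t * l x + (1 - t) * l y.

(** Planar separation: the convex image of [C] under [(f - r, g - r)] misses the open negative
    quadrant, hence lies on one side of a line through the origin whose normal [(1 - t, t)] is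
    nonnegative. *)
Lemma affine_alternative2 C (f g : (I -> R) -> R) (r : R) :
  segment_closed C -> affine f -> affine g ->
  (forall x, C x -> f x < r -> r <= g x) ->
  exists2 t, 0 <= t <= 1 & forall x, C x -> r <= t * g x + (1 - t) * f x.
Proof.
move=> Cc af ag fg; pose F x := f x - r; pose G x := g x - r.
have FG x : C x -> F x < 0 -> 0 <= G x.
  by move=> Cx; rewrite /F /G subr_lt0 subr_ge0; exact: fg.
have [[x0 Cx0 Fx0]|noF] := pselect (exists2 x, C x & F x < 0); last first.
  exists 0; first by rewrite lexx ler01.
  move=> x Cx; rewrite mul0r subr0 mul1r add0r leNgt; apply/negP => fx.
  by apply: noF; exists x => //; rewrite /F subr_lt0.
(* The quotient is the least weight on [G] that makes the combination nonnegative at a point where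
   [F] is negative; the supremum meets all these demands at once. *)
pose S := [set - F x / (G x - F x) | x in [set x | C x /\ F x < 0]].
have S01 s : S s -> 0 <= s <= 1.
  move=> [x [Cx Fx] <-]; have Gx := FG x Cx Fx.
  have GF : 0 < G x - F x by lra.
  by rewrite divr_ge0 ?ler_pdivrMr//; lra.
have S0 : S !=set0 by eexists; exists x0.
have hS : has_ubound S by exists 1 => s /S01/andP[].
have sup0 : 0 <= sup S.
  by have [s Ss] := S0; apply: (le_trans _ (ub_le_sup hS Ss)); case/andP: (S01 _ Ss).
have sup1 : sup S <= 1 by apply: ge_sup => // s /S01/andP[].
exists (sup S); first by rewrite sup0.
move=> x Cx; suff : 0 <= sup S * G x + (1 - sup S) * F x by rewrite /F /G; lra.
have [Fx|Fx] := ltP (F x) 0.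
  have Gx := FG x Cx Fx; have GF : 0 < G x - F x by lra.
  have : - F x / (G x - F x) <= sup S by apply: ub_le_sup => //; exists x.
  by rewrite ler_pdivrMr//; lra.
have [Gx|Gx] := leP 0 (G x); first by rewrite addr_ge0// mulr_ge0// subr_ge0.
have GF : 0 < F x - G x by lra.
(* Points where [G] is negative bound the weight from above by this quotient. That no lower demand
   exceeds an upper one is where convexity of [C] enters. *)
have : sup S <= F x / (F x - G x).
  apply: ge_sup => // _ [y [Cy Fy] <-]; have Gy := FG y Cy Fy.
  have GFy : 0 < G y - F y by lra.
  rewrite ler_pdivrMr// mulrAC ler_pdivlMr//.
  suff : F y * G x <= F x * G y by lra.
  rewrite leNgt; apply/negP => FGxy.
  (* At the point of [y, x] with weights proportional to F x - G x and
     G y - F y, both F and G are a positive multiple of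
     F x * G y - F y * G x < 0. *)
  pose w := F x - G x + (G y - F y); have w0 : 0 < w by rewrite addr_gt0.
  pose t := (F x - G x) / w.
  have t01 : 0 <= t <= 1.
    by rewrite divr_ge0 ?(ltW GF) ?(ltW w0)//= ler_pdivrMr// mul1r lerDl ltW.
  have tw : t * w = F x - G x by rewrite divfK// gt_eqF.
  have Cz := Cc t y x t01 Cy Cx; set z := segment_point t y x in Cz.
  have Fz : w * F z = F x * G y - F y * G x.
    transitivity (t * w * F y + (w - t * w) * F x); last by rewrite tw /w; ring.
    by rewrite /F /z af; ring.
  have Gz : w * G z = F x * G y - F y * G x.
    transitivity (t * w * G y + (w - t * w) * G x); last by rewrite tw /w; ring.
    by rewrite /G /z ag; ring.
  have Fz0 : F z < 0 by rewrite -(pmulr_rlt0 _ w0) Fz; lra.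
  have : 0 <= w * G z by rewrite mulr_ge0 ?(ltW w0)// FG.
  by rewrite Gz; lra.
by rewrite ler_pdivlMr//; lra.
Qed.

(** Induction on the list: the hypothesis is used on the part of [C] where [x i < r]. If it returns
    a functional [l], then [l] and evaluation at [i] are never both below [r] on [C], and the
    two-function case merges them. The claim is strengthened with affinity of [l], which that case
    requires. *)
Lemma affine_alternative (D : set ((I -> R) -> R)) C (r : R) (i0 : I) (s : seq I) :
  (forall i, D (fun x => x i)) ->
  (forall t l m, 0 <= t <= 1 -> D l -> D m ->
    D (fun x => t * l x + (1 - t) * m x)) ->
  segment_closed C ->
  (exists2 x, C x & forall i, List.In i (i0 :: s) -> x i < r) \/
  (exists2 l, D l & forall x, C x -> r <= l x).
Proof.
move=> Deval Dconv Cc.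
suff [//|[l [Dl _] rl]] : (exists2 x, C x & forall i, List.In i (i0 :: s) -> x i < r) \/
    (exists2 l, D l /\ affine l & forall x, C x -> r <= l x).
  by left.
  by right; exists l.
elim: s C Cc => [|i s ih] C Cc.
  have [[x Cx xr]|h] := pselect (exists2 x, C x & x i0 < r).
    by left; exists x => // j [<-|[]].
  right; exists (fun x => x i0) => // x Cx.
  by rewrite leNgt; apply/negP => xr; apply: h; exists x.
have [|[x [Cx xir] xr]|[l [Dl al] rl]] := ih (C `&` [set x | x i < r]).
- move=> t x y t01 [Cx xr] [Cy yr]; split; first exact: Cc.
  have /andP[t0 t1] := t01; rewrite /= /segment_point.
  have : t * (r - x i) >= 0 by rewrite mulr_ge0// subr_ge0 ltW.
  have : (1 - t) * (r - y i) >= 0 by rewrite mulr_ge0// subr_ge0// ltW.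
  (* Strictness comes from [y] when [t = 0] and from [x] otherwise. *)
  have [->|t0'] := eqVneq t 0.
    by move=> _ _; rewrite mul0r subr0 mul1r add0r; exact: yr.
  have : t * (r - x i) > 0 by rewrite mulr_gt0 ?subr_gt0// lt_def t0'.
  lra.
- left; exists x => // j [<-|[<-//|js]]; first by apply: xr; left.
  by apply: xr; right.
- have ai : affine (fun x => x i) by [].
  have [x Cx xr|t t01 ht] := @affine_alternative2 C _ l r Cc ai al.
    exact: rl.
  right; exists (fun x => t * l x + (1 - t) * x i); last exact: ht.
  split; first exact: Dconv.
  by move=> u x y; rewrite al /segment_point; ring.
Qed.

End minimax_alternative.

(** * Expected payoffs and duality *)

Section one_player_payoff.
Context (R : realType) (T : ptopologicalType).
Implicit Types (f : T -> R) (mu nu : probability (borel T) R) (t : {i01 R}).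
Local Open Scope ereal_scope.

Definition integral_payoff mu f : \bar R :=
  \int[mu]_x (Num.max (f x) 0)%:E + \int[mu]_x (Num.min (f x) 0)%:E.

Let pos_ge0 f x : 0 <= (Num.max (f x) 0)%:E.
Proof. by rewrite lee_fin le_max lexx orbT. Qed.

Let oppneg_ge0 f x : 0 <= - (Num.min (f x) 0)%:E.
Proof. by rewrite oppe_ge0 lee_fin ge_min lexx orbT. Qed.

Lemma measurable_pos f : measurable_fun setT (f : borel T -> R) ->
  measurable_fun setT (fun x : borel T => (Num.max (f x) 0)%:E).
Proof.
move=> mf; apply/measurable_EFinP.
by apply: measurable_maxr => //; exact: measurable_cst.
Qed.

Lemma measurable_neg f : measurable_fun setT (f : borel T -> R) ->
  measurable_fun setT (fun x : borel T => (Num.min (f x) 0)%:E).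
Proof.
move=> mf; apply/measurable_EFinP.
by apply: measurable_minr => //; exact: measurable_cst.
Qed.

Lemma integral_negE mu f : \int[mu]_x (Num.min (f x) 0)%:E =
  - \int[mu]_x - (Num.min (f x) 0)%:E.
Proof.
rewrite -integral_ge0N; last by move=> x _; exact: oppneg_ge0.
by apply: eq_integral => x _; rewrite oppeK.
Qed.

Lemma integral_prob_cst mu (k : R) : \int[mu]_x k%:E = k%:E.
Proof.
rewrite integral_cst// [X in _ * X](_ : _ = 1) ?mule1//.
exact: probability_setT.
Qed.

(** Transfers results on nonnegative integrands to payoffs bounded below: [M] is absorbed by the
    negative part, whose integral is therefore finite. *)
Lemma integral_payoff_shift mu f (M : R) : measurable_fun setT (f : borel T -> R) ->
  (0 <= M)%R -> (forall x, (- M <= f x)%R) ->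
  \int[mu]_x (f x + M)%:E = integral_payoff mu f + M%:E.
Proof.
move=> mf M0 fM.
have mfp := measurable_pos mf; have mfn := measurable_neg mf.
have negM x : 0 <= M%:E + (Num.min (f x) 0)%:E.
  by rewrite -EFinD lee_fin -lerBlDl sub0r le_min fM/= oppr_le0.
have mMn : measurable_fun setT (fun x : borel T => M%:E + (Num.min (f x) 0)%:E).
  exact: emeasurable_funD.
have mn : measurable_fun setT (fun x : borel T => - (Num.min (f x) 0)%:E).
  exact: measurableT_comp.
have negE : \int[mu]_x (M%:E + (Num.min (f x) 0)%:E) =
    \int[mu]_x (Num.min (f x) 0)%:E + M%:E.
  have : \int[mu]_x (M%:E + (Num.min (f x) 0)%:E) +
      \int[mu]_x (- (Num.min (f x) 0)%:E) = M%:E.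
    rewrite -ge0_integralD// -[RHS](integral_prob_cst mu).
    by apply: eq_integral => x _; rewrite -EFinN -!EFinD addrK.
  rewrite integral_negE.
  have : 0 <= \int[mu]_x (M%:E + (Num.min (f x) 0)%:E) by exact: integral_ge0.
  have : 0 <= \int[mu]_x - (Num.min (f x) 0)%:E by exact: integral_ge0.
  move: (integral _ _ _) (integral _ _ _) => [s| |] [r| |]//= _ _.
  by move=> [<-]; congr EFin; ring.
rewrite /integral_payoff -addeA -negE -ge0_integralD//.
apply: eq_integral => x _; rewrite -!EFinD; congr EFin.
by rewrite addrCA addr_max_min addr0 addrC.
Qed.

Lemma integral_payoff_gtNy mu f (M : R) : measurable_fun setT (f : borel T -> R) ->
  (forall x, (M <= f x)%R) -> -oo < integral_payoff mu f.
Proof.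
move=> mf fM.
have fM' x : (- `|M| <= f x)%R by rewrite (le_trans _ (fM x))// lerNnormlW.
have := integral_payoff_shift mu mf (normr_ge0 M) fM'.
have : 0 <= \int[mu]_x (f x + `|M|)%:E.
  by apply: integral_ge0 => x _; rewrite lee_fin -lerBlDr sub0r.
by move=> + E; rewrite E; case: integral_payoff => // r; rewrite ltNyr.
Qed.

Lemma ge0_integral_mixture t mu nu (f : T -> \bar R) :
  measurable_fun setT (f : borel T -> \bar R) -> (forall x, 0 <= f x) ->
  \int[mixture t mu nu]_x f x =
    t%:num%:E * \int[mu]_x f x + (1 - t%:num)%:E * \int[nu]_x f x.
Proof.
move=> mf f0; rewrite /mixture ge0_integral_measure_add//.
by rewrite !ge0_integral_mscale.
Qed.

(** Finiteness of [u] and [v] forces all four integrals of parts to be finite, so they recombine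
    linearly. *)
Lemma integral_payoff_mixture t mu nu f (u v : R) :
  measurable_fun setT (f : borel T -> R) ->
  integral_payoff mu f = u%:E -> integral_payoff nu f = v%:E ->
  integral_payoff (mixture t mu nu) f = (t%:num * u + (1 - t%:num) * v)%:E.
Proof.
move=> mf; have mn := measurable_neg mf.
rewrite /integral_payoff !integral_negE !ge0_integral_mixture//; last 2 first.
- exact: measurableT_comp.
- exact: measurable_pos.
have : 0 <= \int[mu]_x (Num.max (f x) 0)%:E by exact: integral_ge0.
have : 0 <= \int[nu]_x (Num.max (f x) 0)%:E by exact: integral_ge0.
have : 0 <= \int[mu]_x - (Num.min (f x) 0)%:E by exact: integral_ge0.
have : 0 <= \int[nu]_x - (Num.min (f x) 0)%:E by exact: integral_ge0.
case: (\int[mu]_x (Num.max _ _)%:E) => [a1| |]//; case: (\int[mu]_x - _) => [b1| |]//;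
  case: (\int[nu]_x (Num.max _ _)%:E) => [a2| |]//; case: (\int[nu]_x - _) => [b2| |]//.
move=> _ _ _ _; rewrite -!EFinM => -[<-] [<-].
by congr EFin; ring.
Qed.

Lemma integral_payoff_point_mass (x : T) f : measurable_fun setT (f : borel T -> R) ->
  integral_payoff (point_mass R x) f = (f x)%:E.
Proof.
move=> mf; rewrite /integral_payoff /point_mass.
rewrite !integral_dirac//; [|exact: measurable_neg|exact: measurable_pos].
by rewrite diracT !mul1e -EFinD addr_max_min addr0.
Qed.

End one_player_payoff.

(** * Second countability, Borel sets of products and supports *)

Section second_countability.
Context (R : realType).

Lemma second_countable_metric (X : metricType R) :
  separable X -> @second_countable X.
Proof.
move=> [D cD dD].
pose B (qn : X * nat) := interior (ball qn.1 qn.2.+1%:R^-1).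
exists (B @` (D `*` setT)).
  by apply: (sub_countable (card_image_le _ _)); apply: countableX.
split=> [_ [qn _ <-]|x W]; first exact: open_interior.
rewrite -nbhs_ballE => -[e /= e0 xeW].
(* Two radii [r] add up to less than [e]; the centre [q] is taken within [r / 2], so that the ball
   of radius [r] about [q] is a neighbourhood of [x]. *)
pose n := Num.truncn (2 / e); pose r : R := n.+1%:R^-1.
have r0 : 0 < r by rewrite invr_gt0.
have re : r + r < e.
  rewrite -mulr2n -mulr_natl ltr_pdivrMr// mulrC -ltr_pdivrMr//.
  exact: truncnS_gt.
have r20 : 0 < r / 2 by rewrite divr_gt0.
have [q [xq Dq]] := dD (interior (ball x (r / 2)))
  (ex_intro _ x (nbhs_singleton (nbhs_interior (nbhsx_ballx _ _ r20)))) (open_interior _).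
have {}xq := interior_subset xq.
exists (B (q, n)); last first.
  move=> y /interior_subset/= qy; apply: xeW.
  apply: (le_ball (ltW re)); apply: ball_triangle qy.
  by apply: le_ball xq; rewrite ler_pdivrMr// ler_pMr// ler1n.
split; first by exists (q, n).
apply: (filterS _ (nbhsx_ballx x _ r20)) => y xy /=.
rewrite -/r (splitr r); apply: ball_triangle xy; exact: ball_sym.
Qed.

Lemma second_countable_subspace (X : topologicalType) (A : set X) (A0 : A !=set0) :
  @second_countable X -> @second_countable (nonempty_subspace A0).
Proof.
move=> [B cB [oB bB]].
exists ((fun U => (set_val : nonempty_subspace A0 -> X) @^-1` U) @` B).
  exact: sub_countable (card_image_le _ _) cB.
split=> [_ [U BU <-]|a V]; first by exists U => //; exact: oB.
rewrite nbhsE => -[_ [[U oU <-] Ua] UV].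
have [W [BW Wa] WU] : filter_from [set W | B W /\ W (set_val a)] id U.
  by apply: bB; exact: open_nbhs_nbhs.
exists (set_val @^-1` W); last by move=> y /= Wy; apply: UV; exact: WU.
by split=> //; exists W.
Qed.

Lemma metrized_subspace (X : metricType R) (A : set X) (A0 : A !=set0) :
  metrized_by (fun a b : nonempty_subspace A0 => mdist (set_val a) (set_val b)).
Proof.
split.
- by move=> x; exact: mdistxx.
- by move=> x y; exact: mdist_ge0.
- by move=> x y; exact: metric_sym.
- by move=> y x z; exact: metric_triangle.
- move=> x U; split.
    rewrite nbhsE => -[_ [[W oW <-] Wx] WU].
    have : nbhs (set_val x) W by exact: open_nbhs_nbhs.
    rewrite -nbhs_ballE => -[e /= e0 xeW]; exists e => // y xy; apply: WU.
    by apply: xeW; rewrite ballEmdist.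
  move=> [e e0 xeU].
  have : nbhs x ((set_val : nonempty_subspace A0 -> X) @^-1` (ball (set_val x) e)).
    apply: (@initial_continuous (nonempty_subspace A0) X set_val).
    exact: nbhsx_ballx.
  by apply: filterS => y /=; rewrite ballEmdist; exact: xeU.
Qed.

Lemma countable_bigcup_measurable d (T : measurableType d) I (D : set I)
    (F : I -> set T) : countable D -> (forall i, D i -> measurable (F i)) ->
  measurable (\bigcup_(i in D) F i).
Proof.
move=> cD mF; rewrite bigcup_set_type; apply: countable_bigcupT_measurable.
  by rewrite (eq_countable (card_setT _)).
by move=> i; apply: mF; exact: set_valP.
Qed.

Lemma borel_prod_open (S T : ptopologicalType) (O : set (S * T)) :
  @second_countable S -> @second_countable T -> open O ->
  measurable (O : set (borel S * borel T)).
Proof.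
move=> [B cB [oB bB]] [C cC [oC bC]] oO.
pose D := (B `*` C) `&` [set UV | UV.1 `*` UV.2 `<=` O].
have -> : O = \bigcup_(UV in D) (UV.1 `*` UV.2).
  apply/seteqP; split=> [[a b] Oab|ab [UV [_ UVO] ?]]; last exact: UVO.
  have [[V W] [/= Va Wb] VWO] : nbhs (a, b) O.
    by apply: open_nbhs_nbhs; split.
  have [U [BU Ua] UV] := bB a V Va; have [U' [CU U'b] UW] := bC b W Wb.
  exists (U, U') => //; split => // -[x y] [/= Ux U'y].
  by apply: VWO; split; [exact: UV|exact: UW].
apply: countable_bigcup_measurable => [|[U V] [[/= BU CV] _]].
  by apply: sub_countable (countableX cB cC); apply: subset_card_le; exact: subIsetl.
by apply: measurableX; apply: sub_sigma_algebra; [exact: oB|exact: oC].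
Qed.

(** Tonelli works with the product sigma-algebra, whereas a game payoff is measurable for the Borel
    sets of the product topology. Countable bases bridge the two: every open set is a countable
    union of open rectangles. *)
Lemma borel_prod_measurable_fun (S T : ptopologicalType) (c : S * T -> R) :
  @second_countable S -> @second_countable T ->
  measurable_fun [set: borel (S * T)%type] c ->
  measurable_fun [set: borel S * borel T] (c : borel S * borel T -> R).
Proof.
move=> cS cT mc _ Y mY; rewrite setTI.
have : @measurable _ (borel (S * T)%type) `<=` @measurable _ (borel S * borel T)%type.
  apply: smallest_sub => [|O oO]; last exact: borel_prod_open.
  split => //; first by move=> E mE; rewrite setTD; exact: measurableC.
  by move=> F mF; exact: bigcupT_measurable.
by apply; rewrite -[X in measurable X]setTI; exact: mc.
Qed.

Lemma countable_bigcup_null d (T : measurableType d)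
    (mu : {measure set T -> \bar R}) (D : set (set T)) : countable D ->
  (forall U, D U -> measurable U /\ mu U = 0%E) -> mu (\bigcup_(U in D) U) = 0%E.
Proof.
move=> cD D0; have [f finj] := countable_injP _ cD.
pose F n := \bigcup_(U in [set U | D U /\ f U = n]) U.
have F0 n : measurable (F n) /\ mu (F n) = 0%E.
  have [[U [DU fU]]|noU] := pselect (exists U, D U /\ f U = n).
    rewrite (_ : F n = U); first exact: D0.
    apply/seteqP; split=> [x [V [DV fV] Vx]|x Ux]; last by exists U.
    by rewrite (_ : U = V)//; apply: finj; rewrite ?inE// fU fV.
  rewrite (_ : F n = set0); first by rewrite measure0.
  by apply/seteqP; split=> [x [V DV _]|//]; case: noU; exists V.
have -> : \bigcup_(U in D) U = \bigcup_n F n.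
  apply/seteqP; split=> [x [U DU Ux]|x [n _ [U [DU _] Ux]]]; last by exists U.
  by exists (f U) => //; exists U.
have : mu.-negligible (\bigcup_n F n).
  apply: negligible_bigcup => n; have [mF muF] := F0 n.
  by apply/negligibleP.
by move/negligibleP; apply; apply: bigcupT_measurable => n; have [] := F0 n.
Qed.

(** An uncountable intersection of full sets need not be full; here the complement of the support is
    the union of the null members of a countable base. *)
Lemma support_full (T : ptopologicalType) (mu : probability (borel T) R) :
  @second_countable T -> mu (Defs.support mu) = 1%E.
Proof.
move=> [B cB [oB bB]].
pose D := B `&` [set U | mu U = 0%E].
have cD : countable D.
  by apply: sub_countable cB; apply: subset_card_le; exact: subIsetl.
have mD U : D U -> measurable (U : set (borel T)).
  by move=> [/oB oU _]; exact: sub_sigma_algebra.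
have suppE : Defs.support mu = ~` (\bigcup_(U in D) U).
  apply/seteqP; split => x.
    move=> sx [U [BU U0] Ux]; have := sx (~` U); apply => //; split.
      by apply: open_closedC; exact: oB.
    rewrite /= probability_setC ?U0 ?sube0//.
    by apply: sub_sigma_algebra; exact: oB.
  move=> nx C [cC C1]; apply: contrapT => nCx; apply: nx.
  have oC : open (~` C) by exact: closed_openC.
  have [U [BU Ux] UC] := bB x (~` C) (@open_nbhs_nbhs _ _ _ (conj oC nCx)).
  exists U => //; split => //=; apply/eqP; rewrite eq_le measure_ge0 andbT.
  have mC : measurable (C : set (borel T)).
    by rewrite -[C]setCK; apply: measurableC; exact: sub_sigma_algebra.
  have <- : mu (~` C) = 0%E by rewrite probability_setC// C1 subee.
  apply: le_measure => //; rewrite inE; last exact: measurableC.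
  by apply: sub_sigma_algebra; exact: oB.
rewrite suppE probability_setC; last first.
  exact: countable_bigcup_measurable.
rewrite [X in (1 - X)%E](_ : _ = 0%E) ?sube0//.
by apply: countable_bigcup_null => // U DU; split; [exact: mD|case: DU].
Qed.

End second_countability.

(** * Finitely supported probabilities *)

Section finite_support.
Context (R : realType) (T : ptopologicalType).
Implicit Types (mu nu : probability (borel T) R).

Lemma closed_borel (C : set T) : closed C -> measurable (C : set (borel T)).
Proof.
move=> cC; rewrite -[C]setCK; apply: measurableC.
by apply: sub_sigma_algebra; exact: closed_openC.
Qed.

Lemma closed_support mu : closed (Defs.support mu).
Proof. by apply: closed_bigI => C []. Qed.

(** The union of the two supports is closed and has full mass under the mixture, hence contains its
    support. *)
Lemma finitely_supported_mixture (t : {i01 R}) mu nu : @second_countable T ->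
  finitely_supported mu -> finitely_supported nu ->
  finitely_supported (mixture t mu nu).
Proof.
move=> cT fmu fnu; rewrite /finitely_supported /=.
have cU : closed (Defs.support mu `|` Defs.support nu).
  by apply: closedU; exact: closed_support.
apply: (@sub_finite_set _ _ (Defs.support mu `|` Defs.support nu)); last first.
  by rewrite finite_setU.
move=> x; apply; split => //.
have full (p : probability (borel T) R) :
    Defs.support p `<=` Defs.support mu `|` Defs.support nu ->
    p (Defs.support mu `|` Defs.support nu) = 1%E.
  move=> pU; apply/eqP; rewrite eq_le probability_le1/=; last exact: closed_borel.
  rewrite -(support_full p cT); apply: le_measure => //; rewrite inE.
    by apply: closed_borel; exact: closed_support.
  exact: closed_borel.
rewrite /= /mixture measure_addE.
transitivity (t%:num%:E * mu (Defs.support mu `|` Defs.support nu) +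
  (1 - t%:num)%:E * nu (Defs.support mu `|` Defs.support nu))%E; first by [].
rewrite (full mu (@subsetUl _ _ _)) (full nu (@subsetUr _ _ _)).
by rewrite !mule1 -EFinD addrC subrK.
Qed.

Lemma finitely_supported_point_mass (x : T) : closed [set x] ->
  finitely_supported (point_mass R x).
Proof.
move=> cx; apply: (@sub_finite_set _ _ [set x]); last exact: finite_set1.
move=> y; apply; split => //.
by rewrite /= /point_mass diracE mem_set.
Qed.

End finite_support.

(** This rearrangement and the next one move a term that may be infinite; the other term is finite,
    and the real bound rules out the infinite case. *)
Lemma lee_sub_swap (R : realType) (m : R) (u w : \bar R) :
  (0 <= w -> 0 <= u -> u < +oo -> m%:E <= u - w -> m%:E + w <= u)%E.
Proof.
case: u w => [u| |] [w| |]//= _ _ _.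
by rewrite -EFinB -EFinD !lee_fin lerBrDr.
Qed.

Lemma gee_sub_swap (R : realType) (s : R) (u w : \bar R) :
  (0 <= u -> 0 <= w -> w < +oo -> u - w <= s%:E -> (- s)%:E + u <= w)%E.
Proof.
case: u w => [u| |] [w| |]//= _ _ _.
by rewrite -EFinB -EFinD !lee_fin => h; lra.
Qed.

(** * Weak duality and safe strategies *)

Section weak_duality.
Context (R : realType) (S T : ptopologicalType) (c : S * T -> R).
Implicit Types (p : probability (borel S) R) (q : probability (borel T) R).
Hypothesis mc : measurable_fun [set: borel S * borel T] (c : borel S * borel T -> R).
Hypothesis c_lb : forall b, has_lbound (range (fun a => c (a, b))).
Hypothesis c_ub : forall a, has_ubound (range (fun b => c (a, b))).
Local Open Scope ereal_scope.

Lemma measurable_section1 b : measurable_fun setT (fun a : borel S => c (a, b)).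
Proof. exact (measurableT_comp mc (pair2_measurable (b : borel T))). Qed.

Lemma measurable_section2 a : measurable_fun setT (fun b : borel T => c (a, b)).
Proof. exact (measurableT_comp mc (pair1_measurable (a : borel S))). Qed.

Let cpos (ab : borel S * borel T) := (Num.max (c ab) 0)%:E.
(** The sign is flipped so that Tonelli applies to this part as well. *)
Let cneg (ab : borel S * borel T) := - (Num.min (c ab) 0)%:E.

Let mpos : measurable_fun setT cpos.
Proof.
apply/measurable_EFinP.
by apply: measurable_maxr => //; exact: measurable_cst.
Qed.

Let mneg : measurable_fun setT cneg.
Proof.
apply: measurableT_comp => //; apply/measurable_EFinP.
by apply: measurable_minr => //; exact: measurable_cst.
Qed.

Let pos_ge0 ab : 0 <= cpos ab.
Proof. by rewrite lee_fin le_max lexx orbT. Qed.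

Let neg_ge0 ab : 0 <= cneg ab.
Proof. by rewrite /cneg oppe_ge0 lee_fin ge_min lexx orbT. Qed.

Let expected_posE p q : expected_pos c p q = \int[p]_a \int[q]_b cpos (a, b).
Proof. by []. Qed.

Let expected_negE p q : expected_neg c p q = - \int[p]_a \int[q]_b cneg (a, b).
Proof.
rewrite -integral_ge0N; last by move=> a _; exact: integral_ge0.
by apply: eq_integral => a _; rewrite -integral_negE.
Qed.

Lemma expected_payoff_point_mass2 p b :
  expected_payoff c p (point_mass R b) = integral_payoff p (fun a => c (a, b)).
Proof.
rewrite /expected_payoff /expected_pos /expected_neg /integral_payoff.
congr (_ + _); apply: eq_integral => a _; rewrite /point_mass.
- rewrite integral_dirac ?diracT ?mul1e//.
  by apply: measurable_pos; exact: measurable_section2.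
- rewrite integral_dirac ?diracT ?mul1e//.
  by apply: measurable_neg; exact: measurable_section2.
Qed.

Lemma expected_payoff_point_mass1 a q :
  expected_payoff c (point_mass R a) q = integral_payoff q (fun b => c (a, b)).
Proof.
rewrite /expected_payoff expected_posE expected_negE /point_mass.
rewrite !integral_dirac//.
- by rewrite !diracT !mul1e /integral_payoff [in RHS]integral_negE.
- exact: (measurable_fun_fubini_tonelli_F cneg).
- exact: (measurable_fun_fubini_tonelli_F cpos).
Qed.

(** Integrates [m <= u - w] without subtracting two integrals that may both be infinite; a negative
    [m] changes sides so that all integrands stay nonnegative. *)
Lemma le_integral_difference (U : ptopologicalType) (mu : probability (borel U) R)
    (u w : borel U -> \bar R) (m : R) :
  measurable_fun setT u -> measurable_fun setT w ->
  (forall x, 0 <= u x) -> (forall x, 0 <= w x) ->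
  (forall x, m%:E + w x <= u x) ->
  m%:E + \int[mu]_x w x <= \int[mu]_x u x.
Proof.
move=> mu_ mw u0 w0 muw; have [m0|m0] := leP 0%R m.
  rewrite -[X in X + _](integral_prob_cst mu) -ge0_integralD//.
  by apply: ge0_le_integral => //; [move=> x _; rewrite adde_ge0|exact: emeasurable_funD].
have mN0 : (0 <= - m)%R by rewrite oppr_ge0 ltW.
have : \int[mu]_x w x <= \int[mu]_x (u x + (- m)%:E).
  apply: ge0_le_integral => //; first exact: emeasurable_funD.
  by move=> x _; rewrite EFinN leeBrDl.
by rewrite ge0_integralD// integral_prob_cst EFinN leeBrDl.
Qed.

(** With [P] and [N] the double integrals of the two parts, integrating the pure payoffs over [p]
    gives [flat + N <= P], and over [q], after Tonelli, [P <= sharp + N]. These are void only if [P]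
    and [N] are both infinite, which safety of [q] excludes. *)
Lemma payoff_flat_le_sharp p q : safe_strategies c q ->
  payoff_flat c q <= payoff_sharp c p.
Proof.
move=> /(_ p); rewrite /expected_payoff_defined expected_posE expected_negE.
set P := \int[p]_a _; set N := \int[p]_a _ => PN.
have P0 : 0 <= P by apply: integral_ge0 => a _; exact: integral_ge0.
have N0 : 0 <= N by apply: integral_ge0 => a _; exact: integral_ge0.
have flatE a : payoff_flat c q <=
    \int[q]_b cpos (a, b) - \int[q]_b cneg (a, b).
  apply: ereal_inf_lbound; exists a => //=.
  by rewrite expected_payoff_point_mass1 /integral_payoff integral_negE.
have sharpE b : \int[p]_a cpos (a, b) - \int[p]_a cneg (a, b) <= payoff_sharp c p.
  apply: ereal_sup_ubound; exists b => //=.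
  by rewrite expected_payoff_point_mass2 /integral_payoff integral_negE.
have pos_fin a : \int[q]_b cpos (a, b) < +oo.
  have [M cM] := c_ub a.
  apply: (@le_lt_trans _ _ (\int[q]_b (`|M|)%:E)); last by rewrite integral_prob_cst ltry.
  apply: ge0_le_integral => //.
    exact: measurableT_comp mpos (pair1_measurable (a : borel S)).
  move=> b _; rewrite lee_fin ge_max normr_ge0 andbT (le_trans _ (ler_norm M))//.
  by apply: cM; exists b.
have neg_fin b : \int[p]_a cneg (a, b) < +oo.
  have [M cM] := c_lb b.
  apply: (@le_lt_trans _ _ (\int[p]_a (`|M|)%:E)); last by rewrite integral_prob_cst ltry.
  apply: ge0_le_integral => //.
    exact: measurableT_comp mneg (pair2_measurable (b : borel T)).
  move=> a _; rewrite lee_fin lerNl le_min oppr_le0 normr_ge0 andbT.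
  by apply: (@le_trans _ _ M); [exact: lerNnormlW|apply: cM; exists a].
have PE : P = \int[q]_b \int[p]_a cpos (a, b) by exact: (fubini_tonelli cpos).
have NE : N = \int[q]_b \int[p]_a cneg (a, b) by exact: (fubini_tonelli cneg).
have flatN (m : R) : payoff_flat c q = m%:E -> m%:E + N <= P.
  move=> mE; apply: le_integral_difference => //.
  - exact: (measurable_fun_fubini_tonelli_F cpos).
  - exact: (measurable_fun_fubini_tonelli_F cneg).
  - by move=> a; exact: integral_ge0.
  - by move=> a; exact: integral_ge0.
  move=> a; apply: lee_sub_swap => //.
  - exact: integral_ge0.
  - exact: integral_ge0.
  - by rewrite -mE.
have sharpN (s : R) : payoff_sharp c p = s%:E -> (- s)%:E + P <= N.
  move=> sE; rewrite PE NE; apply: le_integral_difference => //.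
  - exact: (measurable_fun_fubini_tonelli_G cneg).
  - exact: (measurable_fun_fubini_tonelli_G cpos).
  - by move=> b; exact: integral_ge0.
  - by move=> b; exact: integral_ge0.
  move=> b; apply: gee_sub_swap => //.
  - exact: integral_ge0.
  - exact: integral_ge0.
  - by rewrite -sE.
(* [point], the default element of each space, serves as an arbitrary pure strategy here and
   below. *)
have flaty : payoff_flat c q < +oo.
  apply: le_lt_trans (flatE point) _; apply: le_lt_trans (pos_fin point).
  by rewrite -[leRHS]adde0 leeD2l// oppe_le0; exact: integral_ge0.
have sharpNy : -oo < payoff_sharp c p.
  apply: lt_le_trans _ (sharpE point).
  apply: (@lt_le_trans _ _ (- \int[p]_a cneg (a, point))).
    by rewrite lteNr.
  by rewrite -[leLHS]add0e leeD2r//; exact: integral_ge0.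
case: (payoff_flat c q) flaty flatN => [m _ /(_ m erefl) mNP|//|_ _]; last first.
  exact: leNye.
case: (payoff_sharp c p) sharpNy sharpN => [s _ /(_ s erefl) sPN|_ _|//]; last first.
  exact: leey.
move: mNP sPN P0 N0 PN; case: P {PE} => [P| |]//; case: N {NE} => [N| |]//=.
- by rewrite -!EFinD !lee_fin => *; lra.
- by move=> _ _ _ _ [].
Qed.

(** The lower bounds of [c(., b)] for the finitely many [b] in the support combine into one [M], so
    the negative part has double integral at least [- M]. *)
Lemma finitely_supported_safe q : @second_countable T ->
  finitely_supported q -> safe_strategies c q.
Proof.
move=> cT fq p; right; rewrite expected_negE.
have [M M0 cM] : exists2 M : R, (0 <= M)%R &
    forall a b, Defs.support q b -> (- M <= c (a, b))%R.
  have [s sE] := (finite_seqP (Defs.support q)).1 fq.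
  suff [M M0 cM] : exists2 M : R, (0 <= M)%R & forall a b, b \in s -> (- M <= c (a, b))%R.
    by exists M => // a b; rewrite sE; exact: cM.
  elim: s {sE} => [|b s [M M0 cM]]; first by exists 0%R.
  have [N cN] := c_lb b; exists (M + `|N|)%R; first by rewrite addr_ge0.
  move=> a b'; rewrite inE => /predU1P[->|b's]; last first.
    by rewrite (le_trans _ (cM a b' b's))// lerN2 lerDl.
  apply: (@le_trans _ _ N); last by apply: cN; exists a.
  by rewrite lerNl (le_trans (ler_norm _))// normrN lerDr.
apply: (@lt_le_trans _ _ (- M%:E)); first by rewrite -EFinN ltNyr.
rewrite leeN2 -[leRHS](integral_prob_cst p).
apply: ge0_le_integral => //.
- by move=> a _; exact: integral_ge0.
- exact: (measurable_fun_fubini_tonelli_F cneg).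
move=> a _; rewrite -[leRHS](integral_prob_cst q).
(* The bound by [M] holds on the support only, which is almost everywhere for [q]. *)
apply: ae_ge0_le_integral => //.
  exact: measurableT_comp mneg (pair1_measurable (a : borel S)).
have mS : measurable (Defs.support q : set (borel T)).
  by apply: closed_borel; exact: closed_support.
exists (~` Defs.support q); split.
- exact: measurableC.
- transitivity (1 - q (Defs.support q)); first exact: probability_setC.
  by rewrite support_full// subee.
- move=> b /= h sb; apply: h => _.
  by rewrite lee_fin lerNl le_min cM// oppr_le0 M0.
Qed.

End weak_duality.

(** * The lopsided value *)

Section lopsided_value.
Context (R : realType) (S T : ptopologicalType) (c : S * T -> R).
Implicit Types (p : probability (borel S) R) (q : probability (borel T) R).
Context (d : S -> S -> R).
Hypothesis dS : metrized_by d.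
Hypothesis cT : @second_countable T.
Hypothesis closedT : forall b : T, closed [set b].
Hypothesis mc : measurable_fun [set: borel S * borel T] (c : borel S * borel T -> R).
Hypothesis c_lb : forall b, has_lbound (range (fun a => c (a, b))).
Hypothesis c_ub : forall a, has_ubound (range (fun b => c (a, b))).
Hypothesis c_lsc : forall b, lsc (fun a => c (a, b)).
Context (b0 : T).
Hypothesis c_infc : inf_compact (fun a => (c (a, b0))%:E).
Local Open Scope ereal_scope.

Let payoff p b := expected_payoff c p (point_mass R b).

Let payoffE p b : payoff p b = integral_payoff p (fun a => c (a, b)).
Proof. exact: expected_payoff_point_mass2. Qed.

Let sublevel b (l : R) := [set p : probability (borel S) R | payoff p b <= l%:E].

Let nonneg_shift b : exists2 M : R, (0 <= M)%R & forall a, (- M <= c (a, b))%R.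
Proof.
have [N cN] := c_lb b; exists `|N|%R => // a.
by apply: (@le_trans _ _ N); [exact: lerNnormlW|apply: cN; exists a].
Qed.

Let sublevelE b l M : (0 <= M)%R -> (forall a, (- M <= c (a, b))%R) ->
  sublevel b l =
  [set p : probability (borel S) R | \int[p]_a (c (a, b) + M)%:E <= (l + M)%:E].
Proof.
move=> M0 cM; apply/seteqP; have mb := measurable_section1 mc b.
split => p; rewrite /sublevel/= (integral_payoff_shift _ mb M0 cM) payoffE EFinD.
  by move=> h; rewrite leeD2r.
by rewrite leeD2rE.
Qed.

Let closed_sublevel b l : closed (sublevel b l).
Proof.
have [M M0 cM] := nonneg_shift b; rewrite (sublevelE _ M0 cM).
apply: (closed_lsc_integral_le dS); first exact: lsc_addr.
by move=> a; rewrite -lerBlDr sub0r.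
Qed.

Let compact_sublevel l : compact (sublevel b0 l).
Proof.
have [M M0 cM] := nonneg_shift b0; rewrite (sublevelE _ M0 cM).
apply: (compact_inf_compact_integral_le dS).
- by move=> a; rewrite -lerBlDr sub0r.
- exact: lsc_addr.
move=> r; have : compact [set a | (c (a, b0))%:E <= (r - M)%:E] by exact: c_infc.
congr compact.
by apply/seteqP; split => a /=; rewrite !lee_fin lerBrDr.
Qed.

Let sharp_sublevelE (v : R) : sharp_sublevel c v%:E = \bigcap_b sublevel b v.
Proof.
apply/seteqP; split=> [p pv b _|p pv].
  by apply: le_trans pv; apply: ereal_sup_ubound; exists b.
by apply: ge_ereal_sup => _ [b _ <-]; exact: pv.
Qed.

Lemma compact_sharp_sublevel (v : R) : compact (sharp_sublevel c v%:E).
Proof.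
apply: (@subclosed_compact _ _ (sublevel b0 v)).
- by rewrite sharp_sublevelE; apply: closed_bigI => b _; exact: closed_sublevel.
- exact: compact_sublevel.
- by rewrite sharp_sublevelE => p; exact.
Qed.

Lemma convex_sharp_sublevel (v : R) : convex_probabilities (sharp_sublevel c v%:E).
Proof.
move=> t p p'; rewrite sharp_sublevelE => pv p'v b _.
(* The mixture formula needs finite payoffs: [c(., b)] bounded below excludes one infinity, the
   level [v] the other. *)
have fin (r : probability (borel S) R) : sublevel b v r ->
    exists2 u : R, payoff r b = u%:E & (u <= v)%R.
  rewrite /sublevel/=; have : -oo < payoff r b.
    have [M _ cM] := nonneg_shift b.
    by rewrite payoffE; apply: (integral_payoff_gtNy _ _ cM); exact: measurable_section1.
  by case: (payoff r b) => [u _ uv| |]//; exists u.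
have [u pu uv] := fin p (pv b I); have [w pw wv] := fin p' (p'v b I).
have mb := measurable_section1 mc b.
rewrite /sublevel/= payoffE (integral_payoff_mixture t mb (u := u) (v := w)) -?payoffE//.
have t0 : (0 <= t%:num)%R by [].
have t1 : (t%:num <= 1)%R by [].
rewrite lee_fin.
have h1 : (t%:num * u <= t%:num * v)%R by rewrite ler_wpM2l.
have h2 : ((1 - t%:num) * w <= (1 - t%:num) * v)%R by rewrite ler_wpM2l// subr_ge0.
by rewrite (le_trans (lerD h1 h2))// mulrBl mul1r addrC subrK.
Qed.

(** The alternative is applied to the convex set [C] of real payoff vectors, mixtures giving
    convexity. A functional in [D] is tied to a strategy [q] only on the rows [c(a, .)], which is
    all that the flat payoff tests; the second alternative would thus give a [q] whose flat payoff
    reaches [v]. *)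
Lemma finite_sublevels_meet (v : R) (s : seq T) :
  (forall q, finitely_supported q -> payoff_flat c q < v%:E) ->
  exists p, forall b, List.In b (b0 :: s) -> sublevel b v p.
Proof.
move=> flatv.
pose C := [set phi : T -> R | exists p, forall b, payoff p b = (phi b)%:E].
pose D := [set l : (T -> R) -> R | exists2 q : probability (borel T) R,
  finitely_supported q & forall a,
  expected_payoff c (point_mass R a) q = (l (fun b => c (a, b)))%:E].
have [||| [phi [p pphi] phiv]|[l [q fq ql] lv]] :=
    @affine_alternative R T D C v b0 s.
- move=> b; exists (point_mass R b); first exact: finitely_supported_point_mass.
  move=> a; rewrite -/(payoff _ _) payoffE integral_payoff_point_mass//.
  exact: measurable_section1.
- move=> t l m /andP[t0 t1] [q fq ql] [q' fq' q'm].
  exists (mixture (Itv01 t0 t1) q q'); first exact: finitely_supported_mixture.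
  move=> a; rewrite expected_payoff_point_mass1//.
  rewrite (integral_payoff_mixture _ (u := l (fun b => c (a, b)))
    (v := m (fun b => c (a, b)))).
  + by [].
  + exact: measurable_section2.
  + by rewrite -expected_payoff_point_mass1.
  + by rewrite -expected_payoff_point_mass1.
- move=> t x y /andP[t0 t1] [p px] [p' p'y].
  exists (mixture (Itv01 t0 t1) p p') => b; rewrite payoffE.
  rewrite (integral_payoff_mixture _ (u := x b) (v := y b)).
  + by [].
  + exact: measurable_section1.
  + by rewrite -payoffE.
  + by rewrite -payoffE.
- by exists p => b bs; rewrite /sublevel/= pphi lee_fin ltW// phiv.
- exfalso; have := flatv q fq; apply/negP; rewrite -leNgt.
  apply: le_ereal_inf_tmp => _ [a _ <-]; rewrite ql lee_fin; apply: lv.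
  exists (point_mass R a) => b; rewrite payoffE integral_payoff_point_mass//.
  exact: measurable_section1.
Qed.

Lemma sharp_sublevel_nonempty (v : R) :
  (forall q, finitely_supported q -> payoff_flat c q <= v%:E) ->
  sharp_sublevel c v%:E !=set0.
Proof.
move=> flatv.
pose K (x : seq T * R) :=
  [set p | forall b, List.In b (b0 :: x.1) -> sublevel b (v + x.2)%R p].
(* The slack [x.2] turns the assumed weak bound on flat payoffs into the strict one required for
   finite lists. *)
pose F := filter_from [set x : seq T * R | (0 < x.2)%R] K.
have FF : ProperFilter F.
  apply: filter_from_proper; last first.
    move=> [s e] /= e0; apply: finite_sublevels_meet => q fq.
    by apply: le_lt_trans (flatv q fq) _; rewrite lte_fin ltrDl.
  apply: filter_from_filter; first by exists ([::], 1%R) => /=.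
  move=> [s e] [s' e'] /= e0 e'0; exists (s ++ s', Num.min e e') => /=.
    by rewrite lt_min e0.
  move=> p Kp; split => b bs; apply: (le_trans (Kp b _)).
  - by case: bs => [->|bs]; [left|right; apply/List.in_or_app; left].
  - by rewrite lee_fin lerD2l ge_min lexx.
  - by case: bs => [->|bs]; [left|right; apply/List.in_or_app; right].
  - by rewrite lee_fin lerD2l ge_min lexx orbT.
(* The 1 is arbitrary: the basis element of the empty list places the filter in one compact sublevel
   set at [b0]. *)
have [|mu [_ Fmu]] := @compact_sublevel (v + 1)%R F FF.
  by exists ([::], 1%R) => //= p; apply; left.
exists mu; rewrite sharp_sublevelE => b _; apply/lee_addgt0Pr => e e0.
rewrite -EFinD; apply: (@closed_sublevel b (v + e)%R) => V muV.
apply: Fmu => //; exists ([:: b], e) => //= p; apply.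
by right; left.
Qed.

(** The chain [vf <= vs <= vi] closes up because a strategy in the sharp sublevel at [vf] bounds
    [vi]. Sublevels are taken at real levels, so [vf] is first shown finite: [b0] bounds it below,
    and a pure strategy of the minimizer bounds [vi] above. *)
Lemma lopsided_value : exists v : R,
  [/\ ereal_sup (payoff_flat c @` safe_strategies c) = v%:E,
      ereal_inf (range (payoff_sharp c)) = v%:E,
      ereal_sup (payoff_flat c @` [set q | finitely_supported q]) = v%:E &
      sharp_sublevel c v%:E !=set0].
Proof.
set vs := ereal_sup _; set vi := ereal_inf _; set vf := ereal_sup _.
have vfs : vf <= vs.
  apply: ge_ereal_sup => _ [q fq <-]; apply: ereal_sup_ubound; exists q => //.
  exact: finitely_supported_safe.
have vsi : vs <= vi.
  apply: ge_ereal_sup => _ [q sq <-]; apply: le_ereal_inf_tmp => _ [p _ <-].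
  exact: payoff_flat_le_sharp.
have vfNy : -oo < vf.
  have [M _ cM] := nonneg_shift b0.
  apply: (@lt_le_trans _ _ (- M)%:E); first exact: ltNyr.
  apply: (@le_trans _ _ (payoff_flat c (point_mass R b0))); last first.
    apply: ereal_sup_ubound; exists (point_mass R b0) => //.
    exact: finitely_supported_point_mass.
  apply: le_ereal_inf_tmp => _ [a _ <-].
  rewrite -/(payoff _ _) payoffE integral_payoff_point_mass ?lee_fin//.
  exact: measurable_section1.
have viy : vi < +oo.
  have [M cM] := c_ub point; apply: (@le_lt_trans _ _ M%:E); last exact: ltry.
  apply: (@le_trans _ _ (payoff_sharp c (point_mass R point))).
    by apply: ereal_inf_lbound; exists (point_mass R point).
  apply: ge_ereal_sup => _ [b _ <-].
  rewrite -/(payoff _ _) payoffE integral_payoff_point_mass ?lee_fin//.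
    by apply: cM; exists b.
  exact: measurable_section1.
have [v vE] : exists v : R, vf = v%:E.
  exists (fine vf); rewrite fineK// fin_numElt vfNy.
  exact: le_lt_trans (le_trans vfs vsi) viy.
have [mu mu_v] : sharp_sublevel c v%:E !=set0.
  apply: sharp_sublevel_nonempty => q fq; rewrite -vE.
  by apply: ereal_sup_ubound; exists q.
have viv : vi <= v%:E.
  by apply: le_trans mu_v; apply: ereal_inf_lbound; exists mu.
exists v; split => //; last by exists mu.
- by apply/eqP; rewrite eq_le (le_trans vsi viv)/= -vE.
- by apply/eqP; rewrite eq_le viv/= -vE (le_trans vfs).
Qed.

End lopsided_value.

Theorem theorem18 (R : realType) (X Y : completeMetricType R)
    (sepX : separable X) (sepY : separable Y)
    (A : set X) (B : set Y) (A0 : A !=set0) (B0 : B !=set0)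
    (mA : measurable (A : set (borel X))) (mB : measurable (B : set (borel Y)))
    (c : nonempty_subspace A0 * nonempty_subspace B0 -> R)
    (hc : game_payoff c)
    (c_lsc : forall b, lower_semicontinuous (fun a => (c (a, b))%:E))
    (c_infc : exists b0, inf_compact (fun a => (c (a, b0))%:E)) :
  exists v : \bar R,
    [/\ ereal_sup (payoff_flat c @` safe_strategies c) = v,
        ereal_inf (range (payoff_sharp c)) = v,
        ereal_sup (payoff_flat c @` safe_strategies c) =
          ereal_sup (payoff_flat c @`
            @finitely_supported R (nonempty_subspace B0)) &
        [/\ sharp_sublevel c v !=set0,
            convex_probabilities (sharp_sublevel c v) &
            compact (sharp_sublevel c v)]].
Proof.
have [mc c_lb c_ub] := hc; have [b0 c_infc0] := c_infc.
have cX : @second_countable X by exact: second_countable_metric.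
have cY : @second_countable Y by exact: second_countable_metric.
have cA := second_countable_subspace A0 cX.
have cB := second_countable_subspace B0 cY.
(* Makes point masses finitely supported: a closed singleton of mass one contains the support. *)
have closedB (b : nonempty_subspace B0) : closed [set b].
  have clY : closed [set (set_val b : Y)].
    exact/accessible_closed_set1/hausdorff_accessible/metric_hausdorff.
  have := @closed_comp (nonempty_subspace B0) Y set_val [set (set_val b : Y)]
    (fun x _ => @initial_continuous (nonempty_subspace B0) Y set_val x) clY.
  congr closed; apply/seteqP; split=> [x /= xb|x ->//].
  exact: val_inj.
have mc' := borel_prod_measurable_fun cA cB mc.
have lscA b : lsc (fun a => c (a, b)) by exact/lscP.
have [v [vs vi vf v0]] := lopsided_value (metrized_subspace A0) cB closedB
  mc' c_lb c_ub lscA c_infc0.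
exists v%:E; split => //.
- by rewrite vs -vf.
- split => //.
  + exact: (convex_sharp_sublevel mc' c_lb).
  + exact: (compact_sharp_sublevel (metrized_subspace A0) mc' c_lb lscA c_infc0).
Qed.
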